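(* Consider the online forecasting setting and the algorithm \textsc{Arrows} described in the context. Let $n$ be the horizon, $\sigma>0$ the known noise level, $\delta\in(0,1]$, and run \textsc{Arrows} with $\beta = 24+\frac{8\log(8/\delta)}{\log(n)}$. Let $\theta_{1:n}\in\mathbb{R}^n$ be arbitrary and let the feedback be $y_t=\theta_t+Z_t$, $t=1,\dots,n$, where $Z_1,\dots,Z_n$ are independent zero-mean $\sigma$-subgaussian random variables. Then with probability at least $1-\delta$, the predictions $x_1,\dots,x_n$ of \textsc{Arrows} satisfy $$\sum_{t=1}^n (x_t-\theta_t)^2=\tilde{O}\Big(n^{1/3}\|D\theta_{1:n}\|_1^{2/3}\sigma^{4/3} +|\theta_1|^2 + \|D\theta_{1:n}\|_2^2 + \sigma^2 \Big),$$ where $\tilde O$ hides universal constants and factors logarithmic in $n$ and $1/\delta$.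
   Context: Online forecasting setting: a horizon $n$ is known. An unknown sequence $\theta_{1:n}=(\theta_1,\dots,\theta_n)$ is fixed in advance. At each time $t=1,\dots,n$ the forecaster outputs $x_t$, a function only of $y_1,\dots,y_{t-1}$, then observes $y_t=\theta_t+Z_t$. The quantity $\sum_{t=1}^n(x_t-\theta_t)^2$ is the (dynamic) regret. $D\theta_{1:n}=(\theta_2-\theta_1,\dots,\theta_n-\theta_{n-1})^T$. Logarithms are natural. Haar transform: for $k$ a power of $2$, $H\in\mathbb{R}^{k\times k}$ is the orthonormal discrete Haar wavelet transform: for $v\in\mathbb{R}^k$, $(Hv)_1=k^{-1/2}\sum_i v_i$, and for each level $l=0,\dots,\log_2 k-1$ and $j=1,\dots,2^l$, splitting the block $\{(j-1)k/2^l+1,\dots,jk/2^l\}$ into its first half $I^-$ and second half $I^+$, there is a coefficient $(\sum_{i\in I^+}v_i-\sum_{i\in I^-}v_i)/\sqrt{k/2^l}$. The $2^l$ level-$l$ coefficients form the block $\alpha[l]$, so $Hv=(\alpha_1,\alpha[0],\alpha[1],\dots,\alpha[\log_2k-1])$. $pad_0(y_a,\dots,y_b)$ is the vector $(y_a-\bar y_{a:b},\dots,y_b-\bar y_{a:b})$ (with $\bar y_{a:b}$ the average of $y_a,\dots,y_b$) followed by zeros up to length $k$, the smallest power of $2$ that is $\ge b-a+1$. $T(\cdot)$ is coordinatewise soft thresholding at level $\lambda=\sigma\sqrt{\beta\log n}$: $T(u)_i=\mathrm{sign}(u_i)\max(|u_i|-\lambda,0)$. Algorithm \textsc{Arrows}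 (inputs $n,\sigma,\delta\in(0,1]$, $\beta>24$): set $t_h=1$, $newBin=1$, $y_0=0$. For $t=1,\dots,n$: (a) if $newBin=1$ predict $x_t=y_{t-1}$, otherwise predict $x_t=\bar y_{t_h:t-1}$; (b) set $newBin=0$ and observe $y_t$; (c) let $\tilde y=pad_0(y_{t_h},\dots,y_t)$ with padded length $k$; (d) let $\hat\alpha=T(H\tilde y)$; (e) if $\frac{1}{\sqrt k}\sum_{l=0}^{\log_2k-1}2^{l/2}\|\hat\alpha[l]\|_1>\frac{\sigma}{\sqrt k}$, set $newBin=1$ and $t_h=t+1$ (a restart). *)

(* Defs.v *)
From HB Require Import structures.
From mathcomp Require Import all_boot all_order all_algebra.
From mathcomp Require Import all_classical all_reals all_analysis.
Set Implicit Arguments. Unset Strict Implicit. Unset Printing Implicit Defensive.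
Import Order.TTheory GRing.Theory Num.Theory.
Import numFieldNormedType.Exports.
Local Open Scope classical_set_scope.
Local Open Scope ring_scope.

Section Arrows.
Variable R : realType.

Definition soft (lam u : R) : R := Num.sg u * Num.max (`|u| - lam) 0.

(* Restart statistic of step (e) of ARROWS, for the segment
   yseg = (y_{t_h}, ..., y_t).  Indices are 0-based here:
   L = length, k = 2^m the smallest power of 2 with L <= k,
   v = pad_0(yseg) (entries i < L are y - mean, the rest 0),
   coef l j = level-l Haar coefficient of block j (j < 2^l), where block j
   is {j*(k/2^l), ..., (j+1)*(k/2^l) - 1}, first half I^-, second half I^+. *)
Definition arrows_stat (lam : R) (yseg : seq R) : R :=
  let L := size yseg in
  let m := up_log 2 L in
  let k := (2 ^ m)%N in
  let mean := (\sum_(x <- yseg) x) / L%:R in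
  let v := fun i : nat => if (i < L)%N then nth 0 yseg i - mean else 0 in
  let coef := fun l j : nat =>
    let b := (k %/ 2 ^ l)%N in
    let h := (k %/ 2 ^ l.+1)%N in
    ((\sum_(j * b + h <= i < (j.+1) * b) v i)
      - (\sum_(j * b <= i < j * b + h) v i)) / Num.sqrt (b%:R) in
  (Num.sqrt (k%:R))^-1 *
    \sum_(l < m) Num.sqrt ((2 ^ l)%N%:R) *
      \sum_(j < 2 ^ l) `|soft lam (coef l j)|.

Definition arrows_restart (sigma lam : R) (yseg : seq R) : bool :=
  arrows_stat lam yseg > sigma / Num.sqrt ((2 ^ up_log 2 (size yseg))%N%:R).

Definition arrows_lambda (n : nat) (sigma beta : R) : R :=
  sigma * Num.sqrt (beta * ln (n%:R)).

Definition segment (y : nat -> R) (a b : nat) : seq R :=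
  [seq y i | i <- iota a (b.+1 - a)].

(* State (t_h, newBin) after processing times 1..t (i.e. before time t+1). *)
Fixpoint arrows_state (n : nat) (sigma beta : R) (y : nat -> R) (t : nat)
    : nat * bool :=
  match t with
  | 0 => (1%N, true)
  | t'.+1 =>
      let th := (arrows_state n sigma beta y t').1 in
      if arrows_restart sigma (arrows_lambda n sigma beta) (segment y th t)
      then (t.+1, true) else (th, false)
  end.

(* Prediction x_t (t >= 1) of ARROWS given observations y_1, y_2, ...
   (the value y 0 is ignored; the algorithm uses y_0 = 0). *)
Definition arrows_pred (n : nat) (sigma beta : R) (y : nat -> R) (t : nat) : R :=
  let y0 := fun i : nat => if i == 0%N then 0 else y i in
  let st := arrows_state n sigma beta y0 t.-1 in
  if st.2 then y0 t.-1
  else (\sum_(st.1 <= i < t) y0 i) / (t - st.1)%N%:R.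

End Arrows.

(* Mutual independence of a finite family of real random variables:
   product rule for the joint preimages of any measurable sets
   (taking B i = setT recovers every subfamily). *)
Definition mutually_independent {d} {T : measurableType d} {R : realType}
    (P : probability T R) (n : nat) (X : 'I_n -> T -> R) : Prop :=
  forall B : 'I_n -> set R, (forall i, measurable (B i)) ->
    P (\bigcap_(i in [set: 'I_n]) (X i @^-1` B i)) =
    (\prod_(i < n) P (X i @^-1` B i))%E.

Definition subgaussian {d} {T : measurableType d} {R : realType}
    (P : probability T R) (sigma : R) (X : T -> R) : Prop :=
  forall lam : R,
    ('E_P[fun w => expR (lam * X w)] <= (expR (lam ^+ 2 * sigma ^+ 2 / 2))%:E)%E.

(* Main.v *)
(** Condition on the event that every sum of the noise over an interval of
    length L is at most (lambda/2) sqrt L. All Haar coefficients of the noise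
    are then at most lambda, so soft thresholding never exaggerates the signal
    and hides at most 2 lambda of each of its coefficients.

    Within a bin, the running means predict theta with a loss controlled, by the
    be-the-leader inequality, by the variance of theta over the bin; by Parseval
    and the absence of a restart that variance comes from coefficients of
    size at most 2 lambda, whose level-wise l1 norms are bounded by the total
    variation. Conversely a restart on a bin of length L forces total variation
    of order sigma / sqrt L there. Both estimates are linear in
    L sigma^2 w^2 + sigma V / w for an arbitrary scale w > 0, hence add up over
    the bins, and w is optimised at the end. *)
Require Import Defs.
From HB Require Import structures.
From mathcomp Require Import all_boot all_order all_algebra.
From mathcomp Require Import all_classical all_reals all_analysis.
From mathcomp Require Import measurable_realfun ring lra zify.
Import Order.TTheory GRing.Theory Num.Theory.
Import numFieldNormedType.Exports.
Local Open Scope classical_set_scope.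
Local Open Scope ring_scope.
Set Implicit Arguments. Unset Strict Implicit. Unset Printing Implicit Defensive.

(** * Haar coefficients of centred, zero-padded segments *)

(** The [coef] of [arrows_stat], with the same truncating divisions, so that the two agree term by
    term in [arrows_restartE]. *)
Definition haar {R : realType} (m : nat) (v : nat -> R) (l j : nat) : R :=
  let b := (2 ^ m %/ 2 ^ l)%N in
  let h := (2 ^ m %/ 2 ^ l.+1)%N in
  (\sum_(j * b + h <= i < j.+1 * b) v i - \sum_(j * b <= i < j * b + h) v i)
  / Num.sqrt b%:R.

Definition centered {R : realType} (x : nat -> R) (L i : nat) : R :=
  if (i < L)%N then x i - (\sum_(0 <= s < L) x s) / L%:R else 0.

Lemma expn2_half (m l : nat) : (l < m)%N ->
  (2 ^ m %/ 2 ^ l = 2 * 2 ^ (m - l.+1))%N /\ (2 ^ m %/ 2 ^ l.+1 = 2 ^ (m - l.+1))%N.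
Proof.
move=> lm; split; last by rewrite -expnB.
by rewrite -expnB ?(ltnW lm)// -expnS; congr (2 ^ _)%N; lia.
Qed.

Lemma sum_blocks (R : realType) (v : nat -> R) (b N : nat) :
  \sum_(j < N) \sum_(j * b <= i < j.+1 * b) v i = \sum_(0 <= i < N * b) v i.
Proof.
elim: N => [|N IH]; first by rewrite big_ord0 big_geq.
rewrite big_ord_recr/= IH -big_cat_nat//=.
by rewrite leq_mul2r leqnSn orbT.
Qed.

Lemma sum_even_odd (R : realType) (F : nat -> R) (N : nat) :
  \sum_(j < 2 * N) F j = \sum_(j < N) (F (2 * j)%N + F (2 * j).+1).
Proof.
elim: N => [|N IH]; first by rewrite muln0 !big_ord0.
rewrite [RHS]big_ord_recr/= -IH mulnS !big_ord_recr/= addrA.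
by rewrite mul2n.
Qed.

(** Squared norm of the projection of [v] onto the sequences constant on the [2 ^ l] dyadic blocks
    of length [2 ^ (m - l)]. *)
Definition block_energy {R : realType} (m : nat) (v : nat -> R) (l : nat) : R :=
  \sum_(j < 2 ^ l)
    (\sum_(j * 2 ^ (m - l) <= i < j.+1 * 2 ^ (m - l)) v i) ^+ 2
    / (2 ^ (m - l))%:R.

(** Parallelogram identity on each block: if its halves have length [h] and sums A and B, then (A^2
    + B^2) / h = (A + B)^2 / (2h) + (B - A)^2 / (2h). *)
Lemma block_energyS (R : realType) (m : nat) (v : nat -> R) (l : nat) :
  (l < m)%N ->
  block_energy m v l.+1 = block_energy m v l + \sum_(j < 2 ^ l) haar m v l j ^+ 2.
Proof.
move=> lm; have [eb eh] := expn2_half lm.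
rewrite /block_energy -big_split/= expnS.
rewrite (sum_even_odd (fun j : nat => (\sum_(j * 2 ^ (m - l.+1) <= i < j.+1 * 2 ^ (m - l.+1)) v i) ^+ 2
    / (2 ^ (m - l.+1))%:R)).
apply: eq_bigr => j _; rewrite /haar eb eh.
have -> : (m - l = (m - l.+1).+1)%N by lia.
rewrite expnS; set h := (2 ^ (m - l.+1))%N.
have h0 : (0 < h)%N by rewrite expn_gt0.
have hR : h%:R != 0 :> R by rewrite pnatr_eq0; lia.
rewrite (@big_cat_nat _ _ _ (j * (2 * h) + h)%N (j * (2 * h)) (j.+1 * (2 * h)))//=; [|nia..].
have -> : (2 * j * h = j * (2 * h))%N by nia.
have -> : ((2 * j).+1 * h = j * (2 * h) + h)%N by nia.
have -> : ((2 * j).+2 * h = j.+1 * (2 * h))%N by nia.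
rewrite exprMn exprVn sqr_sqrtr// natrM.
by field; rewrite hR.
Qed.

(** Telescoping of [block_energyS]: at level [m] the blocks are single entries, at level 0 the only
    block yields the mean term. *)
Lemma haar_parseval (R : realType) (m : nat) (v : nat -> R) :
  \sum_(0 <= i < 2 ^ m) v i ^+ 2 =
  (\sum_(0 <= i < 2 ^ m) v i) ^+ 2 / (2 ^ m)%:R +
  \sum_(l < m) \sum_(j < 2 ^ l) haar m v l j ^+ 2.
Proof.
have H : forall l, (l <= m)%N -> block_energy m v l =
    block_energy m v 0 + \sum_(r < l) \sum_(j < 2 ^ r) haar m v r j ^+ 2.
  elim=> [_|l IH lm]; first by rewrite big_ord0 addr0.
  by rewrite block_energyS// IH ?(ltnW lm)// big_ord_recr/= addrA.
have := H m (leqnn m).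
rewrite /block_energy subnn subn0 expn0 big_ord1 mul0n mul1n => <-.
rewrite big_mkord; apply: eq_bigr => i _.
by rewrite !muln1 big_nat1 divr1.
Qed.

Lemma le_dist_sum_diff (R : realType) (v : nat -> R) (p q : nat) : (p <= q)%N ->
  `|v q - v p| <= \sum_(p <= r < q) `|v r.+1 - v r|.
Proof.
move=> pq; rewrite -telescope_sumr//.
exact: ler_norm_sum.
Qed.

(** Pairing each entry of the first half with the one [h] places later bounds the numerator by
    [h * V]. The sum [V] includes the jump out of the block, so the bounds of one level add up to
    the whole variation. *)
Lemma haar_norm_le (R : realType) (m : nat) (v : nat -> R) (l j : nat) :
  (l < m)%N ->
  `|haar m v l j| <= Num.sqrt (2 ^ (m - l))%:R *
    \sum_(j * 2 ^ (m - l) <= i < j.+1 * 2 ^ (m - l)) `|v i.+1 - v i|.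
Proof.
move=> lm; have [eb eh] := expn2_half lm.
rewrite /haar eb eh.
have -> : (m - l = (m - l.+1).+1)%N by lia.
rewrite expnS; set h := (2 ^ (m - l.+1))%N.
have h0 : (0 < h)%N by rewrite expn_gt0.
set V := \sum_(_ <= i < _) `|_|.
have V0 : 0 <= V by apply: sumr_ge0.
have sb : 0 < Num.sqrt ((2 * h)%N%:R : R) by rewrite sqrtr_gt0 ltr0n; lia.
rewrite normrM [X in _ * X]ger0_norm ?invr_ge0 ?sqrtr_ge0//.
rewrite ler_pdivrMr// mulrAC -expr2 sqr_sqrtr// .
have -> : (j.+1 * (2 * h) = (j * (2 * h) + h) + h)%N by nia.
have shift p : \sum_(p <= i < p + h) v i = \sum_(i < h) v (i + p)%N.
  by rewrite -{1}(add0n p) big_addn addKn big_mkord.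
rewrite !shift -sumrB; apply: (le_trans (ler_norm_sum _ _ _)).
apply: (@le_trans _ _ (\sum_(i < h) V)).
  apply: ler_sum => i _.
  have -> : (i + (j * (2 * h) + h) = i + j * (2 * h) + h)%N by lia.
  apply: (le_trans (le_dist_sum_diff v _)); first by lia.
  rewrite /V.
  rewrite (@big_cat_nat _ _ _ (i + j * (2 * h))%N (j * (2 * h)) (j.+1 * (2 * h)))//=; [|have := ltn_ord i; nia..].
  rewrite (@big_cat_nat _ _ _ (i + j * (2 * h) + h)%N (i + j * (2 * h)) (j.+1 * (2 * h)))//=; [|have := ltn_ord i; nia..].
  rewrite addrCA lerDl addr_ge0//; exact: sumr_ge0.
rewrite sumr_const card_ord -[V *+ h]mulr_natl.
by rewrite ler_wpM2r// ler_nat leq_pmull.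
Qed.

Lemma haar_level_norm_le (R : realType) (m : nat) (v : nat -> R) (l : nat) :
  (l < m)%N ->
  \sum_(j < 2 ^ l) `|haar m v l j| <=
  Num.sqrt (2 ^ (m - l))%:R * \sum_(0 <= i < 2 ^ m) `|v i.+1 - v i|.
Proof.
move=> lm.
have -> : (2 ^ m = 2 ^ l * 2 ^ (m - l))%N by rewrite -expnD subnKC// ltnW.
rewrite -sum_blocks mulr_sumr; apply: ler_sum => j _.
exact: haar_norm_le.
Qed.

Lemma dist_mean_le (R : realType) (x : nat -> R) (L : nat) :
  `|x L - (\sum_(0 <= s < L.+1) x s) / L.+1%:R| <=
  \sum_(0 <= i < L) `|x i.+1 - x i|.
Proof.
set V := \sum_(0 <= i < L) _.
have L0 : 0 < L.+1%:R :> R by rewrite ltr0n.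
have -> : x L - (\sum_(0 <= s < L.+1) x s) / L.+1%:R =
    (\sum_(0 <= s < L.+1) (x L - x s)) / L.+1%:R.
  rewrite sumrB sumr_const_nat subn0 mulrBl -[x L *+ _]mulr_natr mulfK//.
rewrite normrM [X in _ * X]gtr0_norm ?invr_gt0// ler_pdivrMr//.
apply: (le_trans (ler_norm_sum _ _ _)).
rewrite mulr_natr -[L.+1 in X in _ <= X]subn0 -sumr_const_nat.
rewrite big_nat [X in _ <= X]big_nat; apply: ler_sum => s /andP[_ sL].
apply: (le_trans (le_dist_sum_diff x _)) => //.
rewrite /V [X in _ <= X](@big_cat_nat _ _ _ s)//=.
by rewrite lerDr sumr_ge0.
Qed.

(** Centring keeps the increments. The only new one is the jump from the last entry to the padding,
    of size the distance of that entry to the mean, which is again at most the variation. *)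
Lemma tv_centered (R : realType) (x : nat -> R) (L K : nat) : (L < K)%N ->
  \sum_(0 <= i < K) `|centered x L.+1 i.+1 - centered x L.+1 i| <=
  2 * \sum_(0 <= i < L) `|x i.+1 - x i|.
Proof.
move=> LK; rewrite (@big_cat_nat _ _ _ L)//= ?(ltnW LK)//.
rewrite [X in _ + X]big_ltn// [X in _ + (_ + X)]big1_seq ?addr0; last first.
  move=> i; rewrite mem_index_iota => /andP[_ /andP[Li _]].
  rewrite /centered !ifF ?subrr ?normr0//; lia.
rewrite mulr_natl mulr2n lerD//.
  rewrite big_nat [X in _ <= X]big_nat ler_sum// => i /andP[_ iL].
  rewrite /centered !ifT; [|lia..].
  by rewrite opprB addrA subrK.
rewrite /centered ltnn ltnSn sub0r normrN.
exact: dist_mean_le.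
Qed.

Lemma sum_centered0 (R : realType) (x : nat -> R) (L K : nat) : (0 < L <= K)%N ->
  \sum_(0 <= i < K) centered x L i = 0.
Proof.
move=> /andP[L0 LK]; rewrite (@big_cat_nat _ _ _ L)//=.
rewrite [X in _ + X]big1_seq ?addr0; last first.
  move=> i; rewrite mem_index_iota => /andP[_ /andP[Li _]].
  by rewrite /centered ifF//; lia.
rewrite (eq_big_nat _ _ (F2 := fun i => x i - (\sum_(0 <= s < L) x s) / L%:R)).
  rewrite sumrB sumr_const_nat subn0 -[(_ / _) *+ _]mulr_natr divfK ?subrr//.
  by rewrite pnatr_eq0; lia.
by move=> i /andP[_ iL]; rewrite /centered iL.
Qed.

Lemma sum_centered_interval (R : realType) (x : nat -> R) (L p q : nat) :
  (p <= q)%N ->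
  \sum_(p <= i < q) centered x L i =
  \sum_(minn p L <= i < minn q L) x i
  - (minn q L - minn p L)%N%:R * ((\sum_(0 <= s < L) x s) / L%:R).
Proof.
move=> pq; set mu := _ / _.
case: (boolP (L <= p)%N) => Lp; last rewrite -ltnNge in Lp.
  rewrite (minn_idPr Lp) (minn_idPr (leq_trans Lp pq)) subnn mul0r subr0.
  rewrite [RHS]big_geq// big1_seq// => i.
  rewrite mem_index_iota => /andP[_ /andP[pi _]].
  by rewrite /centered ifF//; lia.
rewrite (minn_idPl (ltnW Lp)).
have pm : (p <= minn q L)%N by rewrite leq_min pq ltnW.
rewrite (@big_cat_nat _ _ _ (minn q L))//= ?geq_minl//.
rewrite [X in _ + X]big1_seq ?addr0; last first.
  move=> i; rewrite mem_index_iota => /andP[_ /andP[Li iq]].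
  by rewrite /centered ifF//; lia.
rewrite (eq_big_nat _ _ (F2 := fun i => x i - mu)).
  by rewrite sumrB sumr_const_nat mulr_natl.
by move=> i /andP[_ iL]; rewrite /centered ifT//; lia.
Qed.

Lemma centeredD (R : realType) (x z : nat -> R) (L i : nat) :
  centered (fun s => x s + z s) L i = centered x L i + centered z L i.
Proof.
rewrite /centered; case: ifP => _; last by rewrite addr0.
by rewrite big_split/= mulrDl opprD addrACA.
Qed.

Lemma haarD (R : realType) (m : nat) (u v : nat -> R) (l j : nat) :
  haar m (fun i => u i + v i) l j = haar m u l j + haar m v l j.
Proof.
rewrite /haar; set s := (Num.sqrt _)^-1.
by rewrite !big_split/=; ring.
Qed.

Lemma eq_haar (R : realType) (m : nat) (u v : nat -> R) (l j : nat) :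
  u =1 v -> haar m u l j = haar m v l j.
Proof.
move=> uv; rewrite /haar.
by congr ((_ - _) / _); apply: eq_bigr => i _; rewrite uv.
Qed.

(** Here [p] and [q] are the square roots of the lengths of the two halves and [M] the size of the
    mean. After multiplication by [q] the inequality reduces to [c * (p - q / 2) ^+ 2 >= 0]. *)
Lemma unequal_halves_le (R : realType) (c p q M : R) :
  0 <= c -> 0 <= p -> p <= q -> 0 < q -> 0 <= M -> q * M <= c ->
  c * p + c * q + (q ^+ 2 - p ^+ 2) * M <= 9 / 4 * (c * q).
Proof.
move=> c0 p0 pq q0 M0 qM.
rewrite -(ler_pM2l q0).
have H1 : (q ^+ 2 - p ^+ 2) * (q * M) <= (q ^+ 2 - p ^+ 2) * c.
  by apply: ler_wpM2l => //; nra.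
have H2 : 0 <= c * (p - q / 2) ^+ 2 by rewrite mulr_ge0// sqr_ge0.
by nra.
Qed.

Lemma truncated_halves (P h L : nat) :
  let a0 := minn P L in let a1 := minn (P + h) L in let a2 := minn (P + h + h) L in
  [/\ (a0 <= a1 <= L)%N, (a1 <= a2 <= L)%N, (a1 - a0 <= h)%N, (a1 - a0 <= L)%N &
      (a1 - a0 = h /\ a2 - a1 <= h)%N \/ (a2 - a1 = 0)%N].
Proof. by split; lia. Qed.

(* Bounding the two half-block sums and the mean correction separately gives
   3c / sqrt 2 > 2c; but the mean enters with the imbalance of the two halves
   after truncation at L, which is large only when the second half is short. *)
Lemma haar_centered_noise (R : realType) (z : nat -> R) (L m l j : nat) (c : R) :
  0 <= c -> (0 < L)%N -> (2 ^ m < 2 * L)%N -> (l < m)%N ->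
  (forall p q, (p <= q <= L)%N ->
     `|\sum_(p <= i < q) z i| <= c * Num.sqrt (q - p)%N%:R) ->
  `|haar m (centered z L) l j| <= 2 * c.
Proof.
move=> c0 L0 mL lm Hz; have [eb eh] := expn2_half lm.
rewrite /haar eb eh.
(* A half block is at most half of [2 ^ m], so it fits in [L]; its share of the mean is then
   controlled by [HM]. *)
have hL : (2 ^ (m - l.+1) <= L)%N.
  suff : (2 * 2 ^ (m - l.+1) <= 2 ^ m)%N by lia.
  by rewrite -expnS leq_exp2l//; lia.
move: hL; set h := (2 ^ (m - l.+1))%N => hL.
have h0 : (0 < h)%N by rewrite expn_gt0.
set P := (j * (2 * h))%N.
have -> : (j.+1 * (2 * h) = P + h + h)%N by rewrite /P; nia.
rewrite !sum_centered_interval ?leq_addr//.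
set mu := _ / L%:R.
have LR : 0 < L%:R :> R by rewrite ltr0n.
have sL : 0 < Num.sqrt (L%:R : R) by rewrite sqrtr_gt0.
have HM : Num.sqrt L%:R * `|mu| <= c.
  rewrite -(ler_pM2l sL) mulrA -expr2 sqr_sqrtr ?ler0n// /mu.
  rewrite normrM [`|_^-1|]gtr0_norm ?invr_gt0// mulrCA divff ?gt_eqF// mulr1.
  by rewrite mulrC; have := Hz 0%N L; rewrite subn0; apply; rewrite leqnn.
set a0 := minn P L; set a1 := minn (P + h) L; set a2 := minn (P + h + h) L.
have [a01 a12 kh kL Hcase] := truncated_halves P h L.
have Z1 := Hz a0 a1 a01; have Z2 := Hz a1 a2 a12.
have sb : 0 < Num.sqrt ((2 * h)%N%:R : R) by rewrite sqrtr_gt0 ltr0n muln_gt0 h0.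
rewrite normrM [X in _ * X]ger0_norm ?invr_ge0 ?sqrtr_ge0// ler_pdivrMr//.
set q := Num.sqrt (h%:R : R).
have q0 : 0 < q by rewrite sqrtr_gt0 ltr0n.
(* Since 9/8 is below the square root of 2, the bound [9 / 4 * (c * q)] proved below suffices. *)
have qb : 9 / 8 * q <= Num.sqrt (2 * h)%N%:R.
  rewrite natrM sqrtrM// ler_wpM2r ?sqrtr_ge0//.
  have := sqr_sqrtr (ler0n R 2); have := sqrtr_ge0 (2 : R); nra.
have M0 := normr_ge0 mu.
have qsq : q ^+ 2 = h%:R by rewrite sqr_sqrtr.
have psq k : Num.sqrt (k%:R : R) ^+ 2 = k%:R by rewrite sqr_sqrtr.
have mono k k' : (k <= k')%N -> Num.sqrt (k%:R : R) <= Num.sqrt k'%:R.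
  by move=> ?; rewrite ler_sqrt// ler_nat.
suff H : c * Num.sqrt (a2 - a1)%N%:R + c * Num.sqrt (a1 - a0)%N%:R
    + `|(a2 - a1)%N%:R - (a1 - a0)%N%:R| * `|mu| <= 9 / 4 * (c * q).
  apply: (@le_trans _ _ (9 / 4 * (c * q))); last by nra.
  apply: le_trans H.
  set A := \sum_(a1 <= i < a2) _; set B := \sum_(a0 <= i < a1) _.
  have -> : A - (a2 - a1)%N%:R * mu - (B - (a1 - a0)%N%:R * mu)
      = A - B - ((a2 - a1)%N%:R - (a1 - a0)%N%:R) * mu by ring.
  apply: (le_trans (ler_normB _ _)); rewrite normrM lerD2r.
  by apply: (le_trans (ler_normB _ _)); rewrite lerD.
(* Either the first half is complete and only the second is cut at [L], or the second half is
   empty. *)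
case: Hcase => [[-> k2h]|->].
  rewrite distrC ger0_norm ?subr_ge0 ?ler_nat//.
  rewrite -[X in (X - _) * _]qsq -[X in (_ - X) * _]psq.
  apply: unequal_halves_le => //; [exact: mono|].
  by apply: le_trans HM; rewrite ler_wpM2r// mono.
rewrite sqrtr0 mulr0 add0r sub0r normrN ger0_norm//.
rewrite -[X in _ + X * _](psq (a1 - a0)%N).
set p := Num.sqrt (a1 - a0)%N%:R.
have p0 : 0 <= p by rewrite sqrtr_ge0.
have pq : p <= q by exact: mono.
have pM : p * `|mu| <= c.
  by apply: le_trans HM; rewrite ler_wpM2r// mono.
by have : p * (p * `|mu|) <= p * c by [apply: ler_wpM2l]; nra.
Qed.

(** * Soft thresholding and the restart statistic *)

Lemma soft_le (R : realType) (lam u z : R) : 0 <= lam -> `|z| <= lam ->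
  `|soft lam (u + z)| <= `|u|.
Proof.
move=> l0 zl; rewrite /soft normrM.
apply: (@le_trans _ _ (1 * Num.max (`|u + z| - lam) 0)).
  rewrite [`|Num.max _ _|]ger0_norm ?le_max ?lexx ?orbT//.
  rewrite ler_wpM2r ?le_max ?lexx ?orbT// normr_sg; by case: (_ == 0).
rewrite mul1r ge_max normr_ge0 andbT lerBlDr.
by apply: (le_trans (ler_normD _ _)); rewrite lerD2l.
Qed.

(** The noise and the threshold each remove at most [lam]; and what is lost never exceeds the
    coefficient itself. *)
Lemma le_soft (R : realType) (lam u z : R) : 0 <= lam -> `|z| <= lam ->
  `|u| <= `|soft lam (u + z)| + Num.min `|u| (2 * lam).
Proof.
move=> l0 zl.
have H : `|u| <= `|soft lam (u + z)| + 2 * lam.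
  have uz : `|u| <= `|u + z| + lam.
    rewrite -{1}(addrK z u); apply: (le_trans (ler_normB _ _)).
    by rewrite lerD2l.
  have [uz0|ne] := eqVneq (u + z) 0.
    rewrite uz0 normr0 in uz; apply: (le_trans uz).
    by have := normr_ge0 (soft lam (u + z)); lra.
  rewrite /soft normrM normr_sg ne mul1r.
  have := ler_norm (Num.max (`|u + z| - lam) 0).
  have : `|u + z| - lam <= Num.max (`|u + z| - lam) 0 by rewrite le_max lexx.
  lra.
by case: (leP `|u| (2 * lam)) => _; rewrite ?lerDr.
Qed.

(** The restart statistic without the factor 1 / sqrt k, which stands on both sides of the test and
    cancels. *)
Definition restart_sum {R : realType} (lam : R) (m : nat) (v : nat -> R) : R :=
  \sum_(l < m) Num.sqrt ((2 ^ l)%N%:R) *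
    \sum_(j < 2 ^ l) `|soft lam (haar m v l j)|.

Lemma segment_centered (R : realType) (y : nat -> R) (a b i : nat) :
  (if (i < size (segment y a b))%N
   then nth 0 (segment y a b) i -
     (\sum_(x <- segment y a b) x) / (size (segment y a b))%:R else 0)
  = centered (fun s => y (a + s)%N) (b.+1 - a) i.
Proof.
rewrite /segment size_map size_iota /centered; case: ifP => // iL.
rewrite (nth_map 0%N) ?size_iota// nth_iota// big_map.
congr (_ - _ / _); rewrite -{1}(addn0 a) iotaDl big_map.
by rewrite /index_iota subn0.
Qed.

Lemma arrows_restartE (R : realType) (sigma lam : R) (y : nat -> R) (a b : nat) :
  arrows_restart sigma lam (segment y a b) =
  (sigma < restart_sum lam (up_log 2 (b.+1 - a))
             (centered (fun s => y (a + s)%N) (b.+1 - a))).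
Proof.
have sz : size (segment y a b) = (b.+1 - a)%N by rewrite size_map size_iota.
rewrite /arrows_restart /arrows_stat -sz; set m := up_log 2 _.
have k0 : 0 < Num.sqrt ((2 ^ m)%N%:R : R) by rewrite sqrtr_gt0 ltr0n expn_gt0.
rewrite [sigma / _]mulrC ltr_pM2l ?invr_gt0//.
congr (_ < _); rewrite /restart_sum.
apply: eq_bigr => l _; congr (_ * _); apply: eq_bigr => j _.
congr (`|soft _ _|); rewrite -/m /haar.
by congr ((_ - _) / _); apply: eq_bigr => i _; rewrite segment_centered sz.
Qed.

Lemma up_log2_bounds (L : nat) : (0 < L)%N ->
  (L <= 2 ^ up_log 2 L)%N /\ (2 ^ up_log 2 L < 2 * L)%N.
Proof.
case: L => [//|[|L]] _; first by rewrite up_log1.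
have /andP[H1 H2] := @up_log_bounds 2 L.+2 isT isT; split=> //.
have m0 : (0 < up_log 2 L.+2)%N by rewrite up_log_gt0.
by rewrite -(prednK m0) expnS; lia.
Qed.

(** * Concentration of interval sums of the noise *)

(** Spreads an interval sum over all of ['I_n], the index type of the independence hypothesis. *)
Lemma big_ord_interval (R : realType) (F : nat -> R) (n p q : nat) :
  (0 < p)%N -> (q <= n.+1)%N ->
  \sum_(i < n) (if (p <= i.+1 < q)%N then F i.+1 else 0) = \sum_(p <= i < q) F i.
Proof.
move=> p0 qn.
rewrite -(big_mkord xpredT (fun i => if (p <= i.+1 < q)%N then F i.+1 else 0)).
rewrite -(big_add1 _ _ 0 n.+1 xpredT (fun i => if (p <= i < q)%N then F i else 0)).
rewrite -big_mkcond/= [RHS](big_nat_widenl _ 1)// [RHS](big_nat_widen _ _ n.+1)//.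
Qed.

Import HBNNSimple.
Local Open Scope ereal_scope.

Lemma integral_nnsfun_comp (R : realType) (d : measure_display)
    (T : measurableType d) (P : {measure set T -> \bar R}) (W X : T -> R)
    (h : {nnsfun R >-> R}) :
  measurable_fun [set: T] W -> (forall w, 0 <= W w)%R ->
  measurable_fun [set: T] X ->
  \int[P]_w (W w * h (X w))%:E =
  \sum_(y \in range h) y%:E * \int[P]_w (W w * \1_(h @^-1` [set y]) (X w))%:E.
Proof.
move=> mW W0 mX.
transitivity (\int[P]_w
   (\sum_(y \in range h) (y * (W w * \1_(h @^-1` [set y]) (X w)))%:E)).
  apply: eq_integral => w _; rewrite fsumEFin// {1}fimfunE.
  congr EFin; rewrite mulr_fsumr.
  by apply: eq_fsbigr => y _; rewrite mulrCA.
have mI y : measurable_fun [set: T] (fun w => (W w * \1_(h @^-1` [set y]) (X w))%R).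
  apply: measurable_funM; [exact: mW|apply: (measurableT_comp _ mX)]; exact: measurable_indic.
have yI y w : (0 <= y * (W w * \1_(h @^-1` [set y]) (X w)))%R.
  rewrite indicE; case: (boolP (X w \in _)) => [/[!inE]/= <-|_].
    by rewrite mulr1 mulr_ge0.
  by rewrite !mulr0.
rewrite ge0_integral_fsum//=; last 2 first.
- by move=> y; apply/measurable_EFinP; apply: measurable_funM.
- by move=> y w _; rewrite lee_fin.
apply: eq_fsbigr => y; rewrite inE => -[x _ <-].
under eq_integral do rewrite EFinM.
rewrite ge0_integralZl//.
- exact/measurable_EFinP.
- by move=> w _; rewrite lee_fin mulr_ge0.
- by rewrite lee_fin.
Qed.

(** Factorisation against indicators of [X] extends to simple functions by linearity and to [f] by
    monotone convergence. *)
Lemma integral_decouple (R : realType) (d : measure_display)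
    (T : measurableType d) (P : probability T R) (W X : T -> R)
    (f : R -> R) (c : \bar R) :
  measurable_fun [set: T] W -> (forall w, 0 <= W w)%R ->
  measurable_fun [set: T] X -> measurable_fun setT f ->
  (forall x, 0 <= f x)%R -> c \is a fin_num ->
  (forall B : set (R), measurable B ->
     \int[P]_w (W w * \1_B (X w))%:E = c * P (X @^-1` B)) ->
  \int[P]_w (W w * f (X w))%:E = c * \int[P]_w (f (X w))%:E.
Proof.
move=> mW W0 mX mf f0 cfin H.
have mEf : measurable_fun setT (EFin \o f) by exact/measurable_EFinP.
pose h := nnsfun_approx measurableT mEf.
have hf x : (EFin \o h^~ x) @ \oo --> (f x)%:E.
  by apply: (@cvg_nnsfun_approx _ _ _ setT measurableT (EFin \o f)) => // y _; rewrite lee_fin.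
have hfR x : h^~ x @ \oo --> f x by have /fine_cvgP[_] := hf x.
have key (V : T -> R) : measurable_fun [set: T] V -> (forall w, 0 <= V w)%R ->
    \int[P]_w (V w * h n (X w))%:E @[n --> \oo] --> \int[P]_w (V w * f (X w))%:E.
  move=> mV V0.
  rewrite (_ : \int[P]_w (V w * f (X w))%:E
     = \int[P]_w limn (fun n => (V w * h n (X w))%:E)).
    apply: cvg_monotone_convergence => //.
    - move=> n; apply/measurable_EFinP; apply: measurable_funM => //.
      exact: (measurableT_comp _ mX).
    - by move=> n x _; rewrite lee_fin mulr_ge0.
    - move=> t _ n m nm; rewrite lee_fin ler_wpM2l//.
      exact/lefP/nd_nnsfun_approx.
  apply: eq_integral => w _; apply/esym/cvg_lim => //.
  apply: cvg_EFin; first exact: nearW.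
  by apply: cvgMr; exact: hfR.
have E n : \int[P]_w (W w * h n (X w))%:E = c * \int[P]_w (1 * h n (X w))%:E.
  rewrite !integral_nnsfun_comp//.
  have I1 B : measurable B -> \int[P]_w (1 * \1_B (X w))%:E = P (X @^-1` B).
    move=> mB; rewrite -[X @^-1` B]setIT -integral_indic//; last first.
      by rewrite -[X in measurable X]setTI; exact: mX.
    by apply: eq_integral => w _; rewrite mul1r.
  rewrite ge0_mule_fsumr; last first.
    (* The terms have to be nonnegative; a negative [y] has empty preimage because [h n] is
       nonnegative. *)
    move=> y; rewrite I1//; have [y0|y0] := leP 0%R y.
      by rewrite mule_ge0// lee_fin.
    rewrite (_ : X @^-1` _ = set0) ?measure0 ?mule0//.
    apply/seteqP; split=> // w /= hw.
    by have : (0 <= h n (X w))%R by []; rewrite hw leNgt y0.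
  apply: eq_fsbigr => y _.
  by rewrite I1// H// muleCA.
have := key W mW W0.
under eq_fun do rewrite E.
have k1 := key (fun=> 1%R) (measurable_cst _) (fun=> ler01).
move=> kW; apply: (cvg_unique _ kW) => //.
rewrite (_ : \int[P]_w (f (X w))%:E = \int[P]_w (1 * f (X w))%:E).
  exact: cvgeZl.
by apply: eq_integral => w _; rewrite mul1r.
Qed.

Lemma expectation_prod_mutually_independent (R : realType) (d : measure_display)
    (T : measurableType d) (P : probability T R) (n : nat)
    (X : 'I_n -> T -> R) (g : 'I_n -> R -> R) :
  (forall i, measurable_fun [set: T] (X i)) -> mutually_independent P X ->
  (forall i, measurable_fun [set: R] (g i)) -> (forall i x, 0 <= g i x)%R ->
  (forall i, \int[P]_w (g i (X i w))%:E < +oo) ->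
  \int[P]_w (\prod_(i < n) g i (X i w))%:E = \prod_(i < n) \int[P]_w (g i (X i w))%:E.
Proof.
move=> mX indep mg g0 gfin.
have mpre i (B : set R) : measurable B -> measurable (X i @^-1` B).
  by move=> mB; rewrite -[X in measurable X]setTI; exact: mX.
have I1 i (B : set R) : measurable B ->
    \int[P]_w (\1_B (X i w))%:E = P (X i @^-1` B).
  move=> mB; rewrite -[X i @^-1` B]setIT -integral_indic//; exact: mpre.
(* Induction on [k]: the factors of index at least [k] are indicators, the others arbitrary. *)
suff H k : (k <= n)%N -> forall g : 'I_n -> R -> R,
    (forall i, measurable_fun [set: R] (g i)) -> (forall i x, 0 <= g i x)%R ->
    (forall i, \int[P]_w (g i (X i w))%:E < +oo) ->
    (forall i : 'I_n, (k <= i)%N -> exists2 B, measurable B & g i = \1_B) ->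
    \int[P]_w (\prod_(i < n) g i (X i w))%:E = \prod_(i < n) \int[P]_w (g i (X i w))%:E.
  by apply: (H n) => // i; rewrite leqNgt ltn_ord.
elim: k => [_|k IH kn] {mg g0 gfin}g mg g0 gfin gB.
  have /choice[B HB] : forall i : 'I_n, exists B, measurable B /\ g i = \1_B.
    by move=> i; have [B] := gB i isT; exists B.
  transitivity (\int[P]_w (\1_(\bigcap_(i in [set: 'I_n]) (X i @^-1` B i)) w)%:E).
    apply: eq_integral => w _; congr EFin.
    under eq_bigr do rewrite (HB _).2.
    rewrite [in RHS]indicE.
    case: (boolP (w \in _)) => [/[!inE] HI|].
      by rewrite big1// => i _; rewrite indicE mem_set//; exact: HI.
    rewrite notin_setE => /existsNP[i /not_implyP[_ Hi]].
    by rewrite (bigD1 i)//= indicE memNset ?mul0r.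
  rewrite integral_indic// ?setIT; last first.
    by apply: fin_bigcap_measurable => // i _; apply: mpre; exact: (HB i).1.
  transitivity (\prod_(i < n) P (X i @^-1` B i)); first by apply: indep => i; exact: (HB i).1.
  by apply: eq_bigr => i _; rewrite (HB i).2 I1//; exact: (HB i).1.
pose k0 : 'I_n := Ordinal kn.
rewrite (bigD1 k0)//= muleC.
under eq_integral do rewrite (bigD1 k0)//= [(_ * _)%R]mulrC.
apply: (integral_decouple
  (W := fun w => (\prod_(i < n | i != k0) g i (X i w))%R)) => //.
- under eq_fun do rewrite -big_filter.
  apply: measurable_prod => i _.
  exact: (measurableT_comp (mg i) (mX i)).
- by move=> w; apply: prodr_ge0.
- apply: prode_fin_num => i _; rewrite ge0_fin_numE//.
  by apply: integral_ge0 => w _; rewrite lee_fin.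
(* Testing the factor [k0] against an indicator leaves one general factor fewer, so the induction
   hypothesis applies to [g']. *)
move=> B mB.
pose g' i := if i == k0 then \1_B : R -> R else g i.
have g'k i : i != k0 -> g' i = g i by rewrite /g' => /negbTE ->.
have g'0 : g' k0 = \1_B by rewrite /g' eqxx.
have -> : \prod_(i < n | i != k0) \int[P]_w (g i (X i w))%:E * P (X k0 @^-1` B)
    = \prod_(i < n) \int[P]_w (g' i (X i w))%:E.
  rewrite [RHS](bigD1 k0)// g'0 I1// muleC; congr (_ * _).
  by apply: eq_bigr => i ik; rewrite g'k.
rewrite -(IH (ltnW kn) g').
- apply: eq_integral => w _; rewrite [in RHS](bigD1 k0)// g'0 mulrC.
  by congr (EFin (_ * _)%R); apply: eq_bigr => i ik; rewrite g'k.
- move=> i; rewrite /g'; case: eqP => // _; exact: measurable_indic.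
- by move=> i x; rewrite /g'; case: eqP => // _; rewrite indicE.
- move=> i; rewrite /g'; case: eqP => // _; rewrite I1//.
  by rewrite (le_lt_trans (probability_le1 P _)) ?ltry//; exact: mpre.
- move=> i ki; rewrite /g'; case: eqP => [_|/eqP ik]; first by exists B.
  apply: gB; rewrite ltn_neqAle ki andbT eq_sym.
  by apply: contra ik => /eqP ik; apply/eqP/val_inj.
Qed.

(** By independence the moment generating functions multiply, so the variance proxies [sigma ^+ 2]
    add up; indices outside the interval carry the factor 1. *)
Lemma mgf_interval_sum (R : realType) (d : measure_display) (T : measurableType d)
    (P : probability T R) (n : nat) (sigma : R) (Z : nat -> {RV P >-> R})
    (p q : nat) (s : R) :
  mutually_independent P (fun i : 'I_n => (Z i.+1 : T -> R)) ->
  (forall t, (1 <= t <= n)%N -> subgaussian P sigma (Z t)) ->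
  (0 < p <= q)%N -> (q <= n.+1)%N ->
  'E_P[fun w => expR (s * \sum_(p <= i < q) Z i w)%R] <=
  (expR (s ^+ 2 * (sigma ^+ 2 * (q - p)%N%:R) / 2)%R)%:E.
Proof.
move=> indep sub /andP[p0 pq] qn.
pose I (i : 'I_n) := (p <= i.+1 < q)%N.
pose g (i : 'I_n) : R -> R := if I i then (fun x => expR (s * x)) else cst 1%R.
have mg i : measurable_fun [set: R] (g i).
  rewrite /g; case: (I i); last exact: measurable_cst.
  by apply: measurableT_comp => //; apply: measurable_funM.
have gle i : \int[P]_w (g i (Z i.+1 w))%:E <=
    (expR (if I i then s ^+ 2 * sigma ^+ 2 / 2 else 0)%R)%:E.
  rewrite /g; case: (I i).
    by have := sub i.+1 (ltn_ord i) s; rewrite unlock.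
  rewrite (integral_cst P measurableT 1%:E) mul1e expR0. exact: probability_le1.
rewrite unlock.
have -> : \int[P]_w (expR (s * \sum_(p <= i < q) Z i w)%R)%:E =
    \int[P]_w (\prod_(i < n) g i (Z i.+1 w))%:E.
  apply: eq_integral => w _; congr EFin.
  rewrite -(big_ord_interval (fun i => Z i w) p0 qn) mulr_sumr expR_sum.
  apply: eq_bigr => i _; rewrite /g /I; case: ifP => //= _.
  by rewrite mulr0 expR0.
have g0 i x : (0 <= g i x)%R by rewrite /g; case: (I i) => //; exact: expR_ge0.
rewrite (expectation_prod_mutually_independent _ indep)//; last first.
  by move=> i; rewrite (le_lt_trans (gle i)) ?ltry.
apply: (@le_trans _ _ (\prod_(i < n)
    (expR (if I i then s ^+ 2 * sigma ^+ 2 / 2 else 0)%R)%:E)).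
  suff /andP[] : 0 <= \prod_(i < n) \int[P]_w (g i (Z i.+1 w))%:E <= \prod_(i < n)
      (expR (if I i then s ^+ 2 * sigma ^+ 2 / 2 else 0)%R)%:E by [].
  apply: (big_ind2 (fun a b => 0 <= a <= b)); first by rewrite lee01 lexx.
    move=> x1 x2 y1 y2 /andP[x0 xy] /andP[y0 yy].
    by rewrite mule_ge0// lee_pmul.
  by move=> i _; rewrite gle andbT; apply: integral_ge0 => w _; rewrite lee_fin.
rewrite prodEFin -expR_sum lee_fin ler_expR.
rewrite (big_ord_interval (fun=> s ^+ 2 * sigma ^+ 2 / 2)%R p0 qn).
by rewrite sumr_const_nat -mulr_natr; lra.
Qed.

Lemma measurable_norm_gt (R : realType) (d : measure_display) (T : measurableType d)
    (S : T -> R) (u : R) :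
  measurable_fun [set: T] S -> measurable [set w | u < `|S w|]%R.
Proof.
move=> mS; rewrite (_ : mkset _ = [set: T] `&` ((fun x : R => `|x|%R) \o S) @^-1` `]u, +oo[%classic).
  by apply: (measurableT_comp _ mS).
by apply/seteqP; split=> w /=; rewrite in_itv/= andbT => //; case.
Qed.

Lemma subgaussian_tail (R : realType) (d : measure_display) (T : measurableType d)
    (P : probability T R) (S : T -> R) (v u : R) :
  measurable_fun [set: T] S -> (0 < v)%R -> (0 < u)%R ->
  (forall s : R, 'E_P[fun w => expR (s * S w)%R] <= (expR (s ^+ 2 * v / 2)%R)%:E) ->
  P [set w | u < `|S w|]%R <= (2 * expR (- (u ^+ 2 / (2 * v))))%:E.
Proof.
move=> mS v0 u0 H.
have tail (S' : T -> R) : measurable_fun [set: T] S' ->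
    (forall s : R, 'E_P[fun w => expR (s * S' w)%R] <= (expR (s ^+ 2 * v / 2)%R)%:E) ->
    P [set w | u <= S' w]%R <= (expR (- (u ^+ 2 / (2 * v))))%:E.
  move=> mS' H'.
  pose X : {RV P >-> R} := mfun_Sub (mem_set mS').
  (* Chernoff at [u / v], the minimiser of [s ^+ 2 * v / 2 - s * u]. *)
  have r0 : (0 < u / v)%R by rewrite divr_gt0.
  have := chernoff X u r0; rewrite /mmt_gen_fun.
  move=> /le_trans; apply.
  apply: (@le_trans _ _ ((expR ((u / v) ^+ 2 * v / 2)%R)%:E * (expR (- (u / v * u)))%:E)).
    rewrite lee_wpmul2r ?lee_fin ?expR_ge0//.
    rewrite (_ : expR \o _ = fun w => expR (u / v * S' w)%R)//.
    by apply/funext => w /=; rewrite mulrC.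
  rewrite -EFinM -expRD lee_fin ler_expR le_eqVlt; apply/orP; left; apply/eqP.
  by field; rewrite gt_eqF.
have mset (S' : T -> R) : measurable_fun [set: T] S' -> measurable [set w | u <= S' w]%R.
  move=> mS'; rewrite (_ : mkset _ = [set: T] `&` S' @^-1` `[u, +oo[%classic).
    exact: mS'.
  by apply/seteqP; split=> w /=; rewrite in_itv/= andbT => //; case.
apply: (@le_trans _ _ (P ([set w | u <= S w]%R `|` [set w | u <= - S w]%R))).
  apply: le_measure; rewrite ?inE.
  - exact: measurable_norm_gt.
  - by apply: measurableU; apply: mset => //; exact: measurableT_comp.
  - move=> w /=; rewrite ltr_normr => /orP[|] /ltW; by [left|right].
apply: (le_trans (measureU2 _ _ _)).
- exact: mset.
- by apply: mset; exact: measurableT_comp.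
rewrite mulr_natl mulr2n EFinD; apply: leeD; first exact: tail.
apply: tail; first exact: measurableT_comp.
move=> s; have := H (- s)%R; rewrite sqrrN.
by under eq_fun do rewrite mulNr -mulrN.
Qed.

Lemma measure_bigsetU_le (R : realType) (d : measure_display) (T : measurableType d)
    (P : {measure set T -> \bar R}) (I : Type) (s : seq I) (A : I -> set T) :
  (forall i, measurable (A i)) ->
  P (\big[setU/set0]_(i <- s) A i) <= \sum_(i <- s) P (A i).
Proof.
move=> mA; elim: s => [|i s IH]; first by rewrite !big_nil measure0.
rewrite !big_cons; apply: (le_trans (measureU2 _ _ _)) => //.
  exact: bigsetU_measurable.
exact: leeD.
Qed.

(** Union bound over at most [n ^+ 2] intervals. Scaling the deviation by the root of the length
    gives all of them the same tail. *)
Lemma noise_event (R : realType) (d : measure_display) (T : measurableType d)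
    (P : probability T R) (n : nat) (sigma c : R) (Z : nat -> {RV P >-> R}) :
  mutually_independent P (fun i : 'I_n => (Z i.+1 : T -> R)) ->
  (forall t, (1 <= t <= n)%N -> subgaussian P sigma (Z t)) ->
  (0 < sigma)%R -> (0 < c)%R ->
  exists E : set T, [/\ measurable E,
    ((1 - n%:R ^+ 2 * (2 * expR (- (c ^+ 2 / (2 * sigma ^+ 2))))%R)%:E <= P E)%E &
    forall w, E w -> forall p q, (0 < p <= q)%N -> (q <= n.+1)%N ->
      `|\sum_(p <= i < q) Z i w| <= c * Num.sqrt (q - p)%N%:R]%R.
Proof.
move=> indep sub s0 c0.
pose S (p q : nat) := fun w => (\sum_(p <= i < q) Z i w)%R.
have mS p q : measurable_fun [set: T] (S p q) by apply: measurable_sum => i.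
(* The pair (i, j) stands for the interval that starts at i + 1 and has length j + 1; it ends within
   1..n exactly when i + j < n. *)
pose bad (ij : 'I_n * 'I_n) : set T :=
  if (ij.1 + ij.2 < n)%N
  then [set w | c * Num.sqrt ij.2.+1%:R < `|S ij.1.+1 (ij.1.+1 + ij.2.+1)%N w|]%R
  else set0.
have mbad ij : measurable (bad ij).
  by rewrite /bad; case: ifP => // _; exact: measurable_norm_gt.
pose B := \big[setU/set0]_(ij : 'I_n * 'I_n) bad ij.
have mB : measurable B by apply: bigsetU_measurable.
exists (~` B); split.
- exact: measurableC.
- rewrite probability_setC// EFinB leeB//.
  apply: (le_trans (measure_bigsetU_le P _ mbad)).
  apply: (@le_trans _ _ (\sum_(ij : 'I_n * 'I_n)
      (2 * expR (- (c ^+ 2 / (2 * sigma ^+ 2))))%:E)).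
    apply: lee_sum => -[i j] _; rewrite /bad/=.
    case: ifP => [ijn|_]; last by rewrite measure0 lee_fin mulr_ge0 ?expR_ge0.
    have j0 : (0 < j.+1%:R :> R)%R by rewrite ltr0n.
    have E : (c ^+ 2 / (2 * sigma ^+ 2) = (c * Num.sqrt j.+1%:R) ^+ 2 / (2 * (sigma ^+ 2 * j.+1%:R)))%R.
      rewrite exprMn sqr_sqrtr//; field.
      by rewrite gt_eqF//= gt_eqF.
    rewrite E; apply: subgaussian_tail => //.
    + by rewrite mulr_gt0// exprn_gt0.
    + by rewrite mulr_gt0// sqrtr_gt0.
    move=> s; rewrite -[X in (X%:R)%R](addKn i.+1).
    by apply: (mgf_interval_sum _ indep sub); lia.
  rewrite sumEFin lee_fin sumr_const card_prod card_ord.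
  by rewrite -[X in (X <= _)%R]mulr_natl natrM -expr2.
- move=> w Ew p q /andP[p0 pq] qn.
  have [->|npq] := eqVneq p q.
    rewrite (big_geq (leqnn q)) normr0.
    by apply: mulr_ge0; [exact: ltW|exact: sqrtr_ge0].
  have i1 : (p.-1 < n)%N by lia.
  have j1 : ((q - p).-1 < n)%N by lia.
  rewrite leNgt; apply/negP => lt; apply: Ew.
  rewrite /B (bigD1 (Ordinal i1, Ordinal j1))//=; left; rewrite /bad/= ifT; last by lia.
  have -> : (p.-1.+1 = p)%N by lia.
  have -> : ((q - p).-1.+1 = q - p)%N by lia.
  by rewrite subnKC.
Qed.

Local Close Scope ereal_scope.

(** * Losses of the bins *)

(* The scale w is free; optimising it in n sigma^2 w^2 + sigma V / w gives
   n^(1/3) V^(2/3) sigma^(4/3), so that Hoelder's inequality over the bins is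
   replaced by the additivity of budget. *)
Definition budget {R : realType} (sigma w : R) (L : nat) (V : R) : R :=
  L%:R * sigma ^+ 2 * w ^+ 2 + sigma * V / w.

Lemma budget_ge0 (R : realType) (sigma w V : R) (L : nat) :
  0 < sigma -> 0 < w -> 0 <= V -> 0 <= budget sigma w L V.
Proof.
move=> s0 w0 V0; apply: addr_ge0.
  by rewrite !mulr_ge0 ?exprn_ge0// ltW.
by rewrite !mulr_ge0 ?invr_ge0// ltW.
Qed.

Lemma sqrt_le_invr (R : realType) (x w : R) : 0 <= x -> 0 < w ->
  x * w ^+ 2 <= 1 -> Num.sqrt x <= w^-1.
Proof.
move=> x0 w0 xw; rewrite -[leRHS]mul1r ler_pdivlMr// -(ler_pXn2r (n := 2))//.
- by rewrite expr1n exprMn sqr_sqrtr.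
- by rewrite nnegrE mulr_ge0 ?sqrtr_ge0// ltW.
by rewrite nnegrE.
Qed.

(** A coarse level, [2 ^ l <= 2 ^ m * w ^+ 2], has few coefficients, each clipped at [2 * lam]. On a
    fine level one factor of the square is bounded by [2 * lam], the other by the l1 bound, where
    the root of [2 ^ (m - l)] is at most [w^-1]. *)
Lemma thresholded_level_le (R : realType) (m l : nat) (al : nat -> R) (lam w V : R) :
  (l < m)%N -> 0 <= lam -> 0 < w -> 0 <= V ->
  \sum_(j < 2 ^ l) `|al j| <= Num.sqrt (2 ^ (m - l))%:R * V ->
  \sum_(j < 2 ^ l) (Num.min `|al j| (2 * lam)) ^+ 2 <=
  4 * lam ^+ 2 * (2 ^ m)%:R * w ^+ 2 + 2 * lam * V / w.
Proof.
move=> lm l0 w0 V0 H.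
have min0 j : 0 <= Num.min `|al j| (2 * lam) by rewrite le_min normr_ge0 mulr_ge0.
have A0 : 0 <= 4 * lam ^+ 2 * (2 ^ m)%:R * w ^+ 2.
  by rewrite !mulr_ge0// ?exprn_ge0// ltW.
have B0 : 0 <= 2 * lam * V / w by rewrite !mulr_ge0// ?invr_ge0// ltW.
have e2 : (2 ^ m)%:R = (2 ^ l)%:R * (2 ^ (m - l))%:R :> R.
  by rewrite -natrM -expnD subnKC// ltnW.
have p0 : 0 < (2 ^ l)%:R :> R by rewrite ltr0n expn_gt0.
have [h|h] := leP (2 ^ l)%:R ((2 ^ m)%:R * w ^+ 2).
  apply: (@le_trans _ _ (4 * lam ^+ 2 * (2 ^ m)%:R * w ^+ 2)); last by rewrite lerDl.
  apply: (@le_trans _ _ (\sum_(j < 2 ^ l) 4 * lam ^+ 2)).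
    apply: ler_sum => j _.
    have -> : 4 * lam ^+ 2 = (2 * lam) ^+ 2 by ring.
    by rewrite ler_pXn2r ?nnegrE ?mulr_ge0// ge_min lexx orbT.
  rewrite sumr_const card_ord -[X in X <= _]mulr_natr -[X in _ <= X]mulrA.
  by rewrite ler_wpM2l// mulr_ge0// exprn_ge0.
apply: (@le_trans _ _ (2 * lam * V / w)); last by rewrite lerDr.
apply: (@le_trans _ _ (2 * lam * \sum_(j < 2 ^ l) `|al j|)).
  rewrite mulr_sumr; apply: ler_sum => j _; rewrite expr2 mulrC.
  apply: ler_pM => //; first by rewrite ge_min lexx orbT.
  by rewrite ge_min lexx.
rewrite -!mulrA ler_wpM2l// ler_wpM2l//; apply: (le_trans H).
rewrite [X in _ <= X]mulrC ler_wpM2r// sqrt_le_invr//.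
by rewrite -(ler_pM2l p0) mulr1 mulrA -e2 ltW.
Qed.

Lemma sum_sqr_le_sqr_sum (R : realType) (I : Type) (s : seq I) (P : pred I) (F : I -> R) :
  (forall i, 0 <= F i) ->
  \sum_(i <- s | P i) F i ^+ 2 <= (\sum_(i <- s | P i) F i) ^+ 2.
Proof.
move=> F0. elim: s => [|i s IH]; first by rewrite !big_nil expr0n.
rewrite !big_cons; case: ifP => // _.
have : 0 <= \sum_(j <- s | P j) F j by rewrite sumr_ge0.
by have := F0 i; nra.
Qed.

(** By [le_soft] each clean coefficient is at most its thresholded noisy version plus a clipped
    part. Without a restart the former have l1 norm, hence l2 norm, at most [sigma]; the latter are
    summed over the levels by [thresholded_level_le]. *)
Lemma variance_no_restart (R : realType) (x z : nat -> R) (L : nat)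
    (sigma rho w : R) :
  0 < sigma -> 1 <= rho -> 0 < w ->
  (forall l j, (l < up_log 2 L.+1)%N ->
    `|haar (up_log 2 L.+1) (centered z L.+1) l j| <= rho * sigma) ->
  restart_sum (rho * sigma) (up_log 2 L.+1)
    (centered (fun i => x i + z i) L.+1) <= sigma ->
  \sum_(0 <= i < L.+1) (x i - (\sum_(0 <= s < L.+1) x s) / L.+1%:R) ^+ 2 <=
  2 * sigma ^+ 2 + 16 * (up_log 2 L.+1)%:R * rho ^+ 2 *
    budget sigma w L.+1 (\sum_(0 <= i < L) `|x i.+1 - x i|).
Proof.
move=> s0 r1 w0 Hz Hr.
set V := \sum_(0 <= i < L) _; have V0 : 0 <= V by apply: sumr_ge0.
have [Lk kL] := up_log2_bounds (ltn0Sn L).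
move: Hz Hr Lk kL; set m := up_log 2 L.+1 => Hz Hr Lk kL.
set lam := rho * sigma; have l0 : 0 <= lam by rewrite mulr_ge0// ?ltW//; lra.
set mu := _ / _.
pose v := centered x L.+1.
pose be l j := haar m v l j.
pose ga l j := soft lam (haar m (centered (fun i => x i + z i) L.+1) l j).
have Hga l j : (l < m)%N -> `|be l j| <= `|ga l j| + Num.min `|be l j| (2 * lam).
  move=> lm; rewrite /ga (@eq_haar _ m _ (fun i => v i + centered z L.+1 i) l j).
    by rewrite haarD; apply: le_soft => //; exact: Hz.
  by move=> i; rewrite centeredD.
have -> : \sum_(0 <= i < L.+1) (x i - mu) ^+ 2 = \sum_(0 <= i < 2 ^ m) v i ^+ 2.
  rewrite [RHS](@big_cat_nat _ _ _ L.+1)//= [X in _ + X]big1_seq ?addr0.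
    apply: eq_big_nat => i /andP[_ iL]; by rewrite /v /centered iL.
  move=> i; rewrite mem_index_iota => /andP[_ /andP[Li _]].
  by rewrite /v /centered ltnNge Li/= expr0n.
rewrite haar_parseval sum_centered0 ?Lk// expr0n mul0r add0r.
have Sga : \sum_(l < m) \sum_(j < 2 ^ l) `|ga l j| ^+ 2 <= sigma ^+ 2.
  have S1 : \sum_(l < m) \sum_(j < 2 ^ l) `|ga l j| <= sigma.
    apply: le_trans Hr; apply: ler_sum => l _.
    rewrite ler_peMl ?sumr_ge0//.
    by rewrite -{1}sqrtr1 ler_sqrt// ler1n expn_gt0.
  have S0 l : 0 <= \sum_(j < 2 ^ l) `|ga l j| by apply: sumr_ge0.
  apply: (@le_trans _ _ ((\sum_(l < m) \sum_(j < 2 ^ l) `|ga l j|) ^+ 2)).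
    apply: (le_trans _ (sum_sqr_le_sqr_sum _ _ _)) => //.
    by apply: ler_sum => l _; exact: sum_sqr_le_sqr_sum.
  rewrite ler_pXn2r// nnegrE; [exact: sumr_ge0|exact: ltW].
(* The constant 8 absorbs [2 ^ m < 2 * L.+1], the doubled variation of [tv_centered] and
   [rho <= rho ^+ 2]. *)
have Slev (l : 'I_m) : \sum_(j < 2 ^ l) (Num.min `|be l j| (2 * lam)) ^+ 2
    <= 8 * rho ^+ 2 * budget sigma w L.+1 V.
  apply: (le_trans (@thresholded_level_le _ m l (be l) lam w (2 * V) _ _ _ _ _)) => //.
    by rewrite mulr_ge0.
    apply: (le_trans (haar_level_norm_le _ _)) => //.
    by rewrite ler_wpM2l ?sqrtr_ge0//; exact: tv_centered.
  have kL' : (2 ^ m)%:R <= 2 * L.+1%:R :> R by rewrite -natrM ler_nat ltnW.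
  rewrite /budget mulrDr lerD//.
    apply: (@le_trans _ _ (4 * lam ^+ 2 * (2 * L.+1%:R) * w ^+ 2)).
      by rewrite ler_wpM2r ?sqr_ge0// ler_wpM2l// mulr_ge0 ?sqr_ge0.
    by rewrite /lam le_eqVlt; apply/orP; left; apply/eqP; ring.
  have w0' : 0 <= w^-1 by rewrite invr_ge0 ltW.
  rewrite !mulrA ler_wpM2r// ler_wpM2r//.
  have : 0 <= rho * sigma * (rho - 1) by rewrite mulr_ge0// subr_ge0.
  by rewrite -/lam; move: l0; rewrite /lam; nra.
apply: (@le_trans _ _ (\sum_(l < m) \sum_(j < 2 ^ l)
    (2 * `|ga l j| ^+ 2 + 2 * (Num.min `|be l j| (2 * lam)) ^+ 2))).
  apply: ler_sum => l _; apply: ler_sum => j _.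
  rewrite -real_normK ?num_real//.
  have := Hga l j (ltn_ord l); rewrite /be.
  set B := `|haar _ _ _ _|; set G := `|ga _ _|; set M := Num.min _ _.
  have := normr_ge0 (haar m v l j); rewrite -/B => B0 H.
  apply: (@le_trans _ _ ((G + M) ^+ 2)); first by rewrite ler_pXn2r ?nnegrE//; lra.
  by have := sqr_ge0 (G - M); nra.
under eq_bigr do rewrite big_split/= -!mulr_sumr.
rewrite big_split/= -!mulr_sumr; apply: lerD; first by rewrite ler_wpM2l.
apply: (@le_trans _ _ (2 * \sum_(l < m) 8 * rho ^+ 2 * budget sigma w L.+1 V)).
  by rewrite ler_wpM2l//; apply: ler_sum => l _; exact: Slev.
rewrite sumr_const card_ord -[_ *+ m]mulr_natr le_eqVlt; apply/orP; left; apply/eqP; ring.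
Qed.

(** The weight of level [l] complements the factor of [haar_level_norm_le] to the root of [2 ^ m],
    so all levels have the same bound. Then the first term of [budget] pays if
    [2 ^ m * w ^+ 2 >= 1], the second one otherwise. *)
Lemma restart_cost (R : realType) (x z : nat -> R) (L : nat) (sigma lam w : R) :
  0 < sigma -> 0 <= lam -> 0 < w ->
  (forall l j, (l < up_log 2 L.+1)%N ->
    `|haar (up_log 2 L.+1) (centered z L.+1) l j| <= lam) ->
  sigma < restart_sum lam (up_log 2 L.+1)
    (centered (fun i => x i + z i) L.+1) ->
  sigma ^+ 2 <= 2 * (up_log 2 L.+1)%:R *
    budget sigma w L.+1 (\sum_(0 <= i < L) `|x i.+1 - x i|).
Proof.
move=> s0 l0 w0 Hz Hr.
set V := \sum_(0 <= i < L) _; have V0 : 0 <= V by apply: sumr_ge0.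
have [Lk kL] := up_log2_bounds (ltn0Sn L).
move: Hz Hr Lk kL; set m := up_log 2 L.+1 => Hz Hr Lk kL.
have Hs : sigma <= m%:R * (Num.sqrt (2 ^ m)%:R * (2 * V)).
  rewrite (_ : m%:R * _ = \sum_(l < m) Num.sqrt (2 ^ m)%:R * (2 * V)); last first.
    by rewrite sumr_const card_ord mulr_natl.
  apply: (le_trans (ltW Hr)).
  apply: ler_sum => l _.
  have -> : (2 ^ m)%:R = (2 ^ l)%:R * (2 ^ (m - l))%:R :> R.
    by rewrite -natrM -expnD subnKC// ltnW.
  rewrite sqrtrM// -mulrA ler_wpM2l ?sqrtr_ge0//.
  apply: (@le_trans _ _ (\sum_(j < 2 ^ l) `|haar m (centered x L.+1) l j|)).
    apply: ler_sum => j _.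
    rewrite (@eq_haar _ m _ (fun i => centered x L.+1 i + centered z L.+1 i) l j).
      by rewrite haarD; apply: soft_le => //; exact: Hz.
    by move=> i; rewrite centeredD.
  apply: (le_trans (haar_level_norm_le _ _)) => //.
  by rewrite ler_wpM2l ?sqrtr_ge0//; exact: tv_centered.
have m1 : 1 <= m%:R :> R.
  rewrite ler1n lt0n; apply/negP => /eqP m0; move: Hs; rewrite m0 mul0r; lra.
have B1 : 0 <= L.+1%:R * sigma ^+ 2 * w ^+ 2.
  by apply: mulr_ge0; [apply: mulr_ge0 => //|]; exact: sqr_ge0.
have B2 : 0 <= sigma * V / w by rewrite !mulr_ge0 ?invr_ge0// ltW.
rewrite /budget; have [h|h] := leP 1 ((2 ^ m)%:R * w ^+ 2).
  have kL' : (2 ^ m)%:R <= 2 * L.+1%:R :> R by rewrite -natrM ler_nat ltnW.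
  have h2 : 1 <= 2 * L.+1%:R * w ^+ 2 by apply: (le_trans h); rewrite ler_wpM2r ?sqr_ge0.
  have : sigma ^+ 2 * 1 <= sigma ^+ 2 * (2 * L.+1%:R * w ^+ 2) by rewrite ler_wpM2l ?sqr_ge0.
  nra.
have h2 : Num.sqrt (2 ^ m)%:R <= w^-1 by rewrite sqrt_le_invr// ltW.
have : sigma * sigma <= sigma * (m%:R * (w^-1 * (2 * V))).
  rewrite ler_pM2l//; apply: (le_trans Hs); rewrite ler_wpM2l//.
  by rewrite ler_wpM2r// mulr_ge0.
nra.
Qed.

(** * Running means as predictors *)

Lemma sum_sqr_dist_mean_le (R : realType) (x : nat -> R) (N : nat) (u : R) :
  \sum_(0 <= i < N.+1) (x i - (\sum_(0 <= s < N.+1) x s) / N.+1%:R) ^+ 2 <=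
  \sum_(0 <= i < N.+1) (x i - u) ^+ 2.
Proof.
have N0 : 0 < N.+1%:R :> R by rewrite ltr0n.
set S := \sum_(0 <= s < N.+1) x s; set A := S / _.
rewrite -subr_ge0 -sumrB.
rewrite (eq_bigr (fun i => 2 * (A - u) * x i - (A - u) * (A + u))); last first.
  by move=> i _; ring.
rewrite sumrB -mulr_sumr sumr_const_nat subn0 -/S -[_ *+ N.+1]mulr_natr.
have -> : S = A * N.+1%:R by rewrite divfK// gt_eqF.
have -> : 2 * (A - u) * (A * N.+1%:R) - (A - u) * (A + u) * N.+1%:R
  = (A - u) ^+ 2 * N.+1%:R by ring.
by rewrite mulr_ge0 ?sqr_ge0.
Qed.

(** Induction for all [u] at once: it suffices to compare with the final mean, where the last terms
    coincide and the induction hypothesis covers the rest. *)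
Lemma be_the_leader (R : realType) (x : nat -> R) (N : nat) (u : R) :
  \sum_(0 <= i < N) (x i - (\sum_(0 <= s < i.+1) x s) / i.+1%:R) ^+ 2 <=
  \sum_(0 <= i < N) (x i - u) ^+ 2.
Proof.
elim: N u => [|N IH] u; first by rewrite !big_geq.
apply: le_trans (sum_sqr_dist_mean_le x N u).
by rewrite !(big_nat_recr N)//= lerD2r; exact: IH.
Qed.

Lemma harmonic_le (R : realType) (N : nat) :
  \sum_(0 <= i < N.+1) i.+1%:R^-1 <= 1 + ln N.+1%:R :> R.
Proof.
elim: N => [|N IH]; first by rewrite big_nat1 invr1 ln1 addr0.
rewrite big_nat_recr//=.
have N1 : 0 < N.+1%:R :> R by rewrite ltr0n.
have N2 : 0 < N.+2%:R :> R by rewrite ltr0n.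
have : ln (N.+1%:R / N.+2%:R) <= - N.+2%:R^-1 :> R.
  have -> : N.+1%:R / N.+2%:R = 1 + - N.+2%:R^-1 :> R.
    have -> : N.+1%:R = N.+2%:R - 1 :> R by rewrite -[N.+2%:R]natr1 addrK.
    by rewrite mulrBl divff ?gt_eqF// mul1r.
  by apply: le_ln1Dx; rewrite ltrN2 invf_lt1// ltr1n.
rewrite ln_div ?posrE//; move: IH.
move: (\sum_(0 <= i < N.+1) _) (ln _) (ln _) (_^-1) => S a b c; lra.
Qed.

(** The error splits into the averaged noise, the distance of [x i] to a mean that already includes
    it, and the step to [x i.+1]. The averaged noise sums harmonically, which is the source of the
    logarithm. *)
Lemma mean_prediction_cost (R : realType) (x z : nat -> R) (N : nat)
    (sigma rho w : R) :
  0 < sigma -> 1 <= rho -> 0 < w ->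
  (forall p q, (p <= q <= N.+1)%N ->
     `|\sum_(p <= i < q) z i| <= rho * sigma / 2 * Num.sqrt (q - p)%N%:R) ->
  restart_sum (rho * sigma) (up_log 2 N.+1)
    (centered (fun i => x i + z i) N.+1) <= sigma ->
  \sum_(0 <= i < N.+1)
     ((\sum_(0 <= s < i.+1) (x s + z s)) / i.+1%:R - x i.+1) ^+ 2 <=
  3 / 4 * rho ^+ 2 * sigma ^+ 2 * (1 + ln N.+1%:R) + 6 * sigma ^+ 2
  + 48 * (up_log 2 N.+1)%:R * rho ^+ 2 *
      budget sigma w N.+1 (\sum_(0 <= i < N) `|x i.+1 - x i|)
  + 3 * \sum_(0 <= i < N.+1) (x i.+1 - x i) ^+ 2.
Proof.
move=> s0 r1 w0 Hz Hr.
have c0 : 0 <= rho * sigma / 2 by rewrite !mulr_ge0// ?ltW//; lra.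
have [_ kL] := up_log2_bounds (ltn0Sn N).
have HV : \sum_(0 <= i < N.+1) (x i - (\sum_(0 <= s < i.+1) x s) / i.+1%:R) ^+ 2
    <= 2 * sigma ^+ 2 + 16 * (up_log 2 N.+1)%:R * rho ^+ 2 *
      budget sigma w N.+1 (\sum_(0 <= i < N) `|x i.+1 - x i|).
  apply: (le_trans (be_the_leader _ _ _)).
  apply: variance_no_restart Hr => // l j lm.
  rewrite (_ : rho * sigma = 2 * (rho * sigma / 2)); last by field.
  exact: haar_centered_noise.
have HZ : \sum_(0 <= i < N.+1) ((\sum_(0 <= s < i.+1) z s) / i.+1%:R) ^+ 2
    <= rho ^+ 2 * sigma ^+ 2 / 4 * (1 + ln N.+1%:R).
  apply: (@le_trans _ _ (rho ^+ 2 * sigma ^+ 2 / 4 *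
      \sum_(0 <= i < N.+1) i.+1%:R^-1)); last first.
    rewrite ler_wpM2l ?harmonic_le// mulr_ge0// mulr_ge0 ?sqr_ge0//.
  rewrite mulr_sumr big_nat [leRHS]big_nat; apply: ler_sum => i /andP[_ iN].
  have i0 : 0 < i.+1%:R :> R by rewrite ltr0n.
  have := Hz 0%N i.+1 ltac:(lia); rewrite subn0 => Hi.
  rewrite expr_div_n ler_pdivrMr ?exprn_gt0//.
  rewrite [leRHS](_ : _ = (rho * sigma / 2) ^+ 2 * i.+1%:R); last first.
    by field; rewrite gt_eqF.
  rewrite -[i.+1%:R in leRHS]sqr_sqrtr// -exprMn -[leLHS]real_normK ?num_real//.
  by rewrite ler_pXn2r ?nnegrE// (mulr_ge0 c0).
apply: (@le_trans _ _ (3 * \sum_(0 <= i < N.+1) ((\sum_(0 <= s < i.+1) z s) / i.+1%:R) ^+ 2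
  + 3 * \sum_(0 <= i < N.+1) (x i - (\sum_(0 <= s < i.+1) x s) / i.+1%:R) ^+ 2
  + 3 * \sum_(0 <= i < N.+1) (x i.+1 - x i) ^+ 2)).
  rewrite !mulr_sumr -!big_split/=; apply: ler_sum => i _.
  rewrite big_split/= mulrDl.
  set A := _ / _; set B := _ / _.
  have := sqr_ge0 (B - (A - x i)); have := sqr_ge0 (B + (x i.+1 - x i)).
  have := sqr_ge0 ((A - x i) + (x i.+1 - x i)).
  by nra.
by lra.
Qed.

(** * The cost of a single bin *)

Lemma sum_shift (R : realType) (F : nat -> R) (a p q : nat) :
  \sum_(p <= i < q) F (a + i)%N = \sum_(a + p <= i < a + q) F i.
Proof.
rewrite [(a + p)%N]addnC big_addn addKn.
by apply: eq_bigr => i _; rewrite addnC.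
Qed.

Lemma sum_shift0 (R : realType) (F : nat -> R) (a q : nat) :
  \sum_(0 <= i < q) F (a + i)%N = \sum_(a <= i < a + q) F i.
Proof. by rewrite sum_shift addn0. Qed.

Definition interval_noise_bound {R : realType} (z : nat -> R) (n : nat) (c : R) :=
  forall p q, (0 < p <= q)%N -> (q <= n.+1)%N ->
    `|\sum_(p <= i < q) z i| <= c * Num.sqrt (q - p)%N%:R.

Lemma interval_noise_bound_shift (R : realType) (z : nat -> R) (n a N : nat) (c : R) :
  interval_noise_bound z n c -> (0 < a)%N -> (a + N <= n)%N ->
  forall p q, (p <= q <= N.+1)%N ->
    `|\sum_(p <= i < q) z (a + i)%N| <= c * Num.sqrt (q - p)%N%:R.
Proof.
move=> Hz a0 aN p q pq; rewrite sum_shift.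
by have := Hz (a + p)%N (a + q)%N; rewrite subnDl; apply; lia.
Qed.

(** The loss at times [a] to [a + N] if a bin opens at [a] and is still open when time [a + N] is
    predicted. *)
Definition bin_loss {R : realType} (theta y : nat -> R) (a N : nat) : R :=
  (y a.-1 - theta a) ^+ 2 +
  \sum_(0 <= i < N)
    ((\sum_(0 <= s < i.+1) y (a + s)%N) / i.+1%:R - theta (a + i.+1)%N) ^+ 2.

(** The test is assumed silent only up to [a + N - 1], the last observation that the predictions
    use; the bound thus also covers a bin closed by a restart at [a + N]. *)
Lemma bin_loss_le (R : realType) (theta z : nat -> R) (n a N : nat)
    (sigma rho w : R) :
  0 < sigma -> 1 <= rho -> 0 < w -> (0 < a)%N -> (a + N <= n)%N -> z 0%N = 0 ->
  interval_noise_bound z n (rho * sigma / 2) ->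
  ((0 < N)%N -> ~~ arrows_restart sigma (rho * sigma)
      (segment (fun t => theta t + z t) a (a + N).-1)) ->
  bin_loss theta (fun t => theta t + z t) a N <=
  3 * \sum_(a.-1 <= t < a + N) (theta t.+1 - theta t) ^+ 2
  + 48 * (up_log 2 n)%:R * rho ^+ 2 *
      budget sigma w N.+1 (\sum_(a <= t < a + N) `|theta t.+1 - theta t|)
  + 8 * rho ^+ 2 * (1 + ln n%:R) * sigma ^+ 2.
Proof.
move=> s0 r1 w0 a0 aN z0 Hz Hr.
set D := fun t => theta t.+1 - theta t.
have c0 : 0 <= rho * sigma / 2 by rewrite !mulr_ge0// ?ltW//; lra.
have lnn : 0 <= ln n%:R :> R.
  by rewrite ln_ge0// ler1n (leq_trans a0)// (leq_trans (leq_addr _ _) aN).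
(* For [a = 1] the previous observation is the conventional [y 0], without noise; otherwise an
   interval of length one is used. *)
have Hza : z a.-1 ^+ 2 <= rho ^+ 2 * sigma ^+ 2 / 4.
  have -> : rho ^+ 2 * sigma ^+ 2 / 4 = (rho * sigma / 2) ^+ 2 by field.
  rewrite -[leLHS]real_normK ?num_real// ler_pXn2r ?nnegrE//.
  case: a a0 aN {Hr} => [//|[|a]] _ aN; first by rewrite z0 normr0.
  have := Hz a.+1 a.+2 ltac:(lia) ltac:(lia).
  by rewrite big_nat1 subSnn sqrtr1 mulr1.
have H1 : (theta a.-1 + z a.-1 - theta a) ^+ 2 <=
    2 * D a.-1 ^+ 2 + rho ^+ 2 * sigma ^+ 2 / 2.
  rewrite /D prednK//; move: Hza (sqr_ge0 (z a.-1 + (theta a - theta a.-1))).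
  by move: (theta _) (theta _) (z _) => *; nra.
set V := \sum_(a <= t < a + N) _; have V0 : 0 <= V by apply: sumr_ge0.
have B0 := budget_ge0 N.+1 s0 w0 V0.
have D0 q r : 0 <= \sum_(q <= t < r) D t ^+ 2 by apply: sumr_ge0 => t _; exact: sqr_ge0.
have rr1 : 1 <= rho ^+ 2 by nra.
have ss0 : 0 <= sigma ^+ 2 by exact: sqr_ge0.
have rs : sigma ^+ 2 <= rho ^+ 2 * sigma ^+ 2 by nra.
have rsl : 0 <= rho ^+ 2 * sigma ^+ 2 * ln n%:R by rewrite !mulr_ge0//; nra.
have MB : 0 <= 48 * (up_log 2 n)%:R * rho ^+ 2 * budget sigma w N.+1 V.
  by rewrite !mulr_ge0//; nra.
have -> : \sum_(a.-1 <= t < a + N) D t ^+ 2 =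
    D a.-1 ^+ 2 + \sum_(a <= t < a + N) D t ^+ 2.
  by rewrite big_ltn ?prednK// (leq_trans _ (leq_addr _ _))// prednK.
have D00 := sqr_ge0 (D a.-1).
rewrite /bin_loss; case: N => [|N] in aN Hr V V0 B0 MB *.
  by rewrite addn0 !big_geq// !addr0; nra.
have aN' : (a + N <= n)%N by rewrite (leq_trans _ aN)// addnS.
have Nn : (N.+1 <= n)%N := leq_trans (leq_addl _ _) aN.
have Hc := @mean_prediction_cost _ (fun i => theta (a + i)%N)
  (fun i => z (a + i)%N) N sigma rho w s0 r1 w0.
have {}Hc := Hc (fun p q pq => interval_noise_bound_shift Hz a0 aN' pq).
have {Hr}Hr := Hr isT.
rewrite addnS/= arrows_restartE -leNgt in Hr.
have e1 : ((a + N).+1 - a = N.+1)%N by rewrite -addnS addKn.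
rewrite e1 in Hr; have {}Hc := Hc Hr.
have lnN : ln N.+1%:R <= ln n%:R :> R.
  by rewrite ler_ln ?posrE ?ltr0n ?ler_nat// (leq_trans _ Nn).
have rsN : rho ^+ 2 * sigma ^+ 2 * (1 + ln N.+1%:R) <=
    rho ^+ 2 * sigma ^+ 2 * (1 + ln n%:R).
  by rewrite ler_wpM2l ?lerD2l//; nra.
have Mle : (up_log 2 N.+1)%:R <= (up_log 2 n)%:R :> R.
  by rewrite ler_nat leq_up_log.
have E2 : \sum_(0 <= i < N.+1) (theta (a + i.+1)%N - theta (a + i)%N) ^+ 2
    = \sum_(a <= t < a + N.+1) D t ^+ 2.
  rewrite -(sum_shift0 (fun t => D t ^+ 2)); apply: eq_bigr => i _.
  by rewrite /D addnS.
have E3 : \sum_(0 <= i < N) `|theta (a + i.+1)%N - theta (a + i)%N| <= V.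
  rewrite /V -(sum_shift0 (fun t => `|D t|)) big_nat_recr//=.
  rewrite (eq_bigr (fun i => `|D (a + i)%N|)) ?lerDl// => i _.
  by rewrite /D addnS.
have E4 : budget sigma w N.+1 (\sum_(0 <= i < N) `|theta (a + i.+1)%N - theta (a + i)%N|)
    <= budget sigma w N.+2 V.
  rewrite /budget; apply: lerD.
    by rewrite !ler_wpM2r ?sqr_ge0// ler_nat.
  by rewrite ler_wpM2r ?invr_ge0 ?(ltW w0)// ler_wpM2l// ltW.
have E5 : 48 * (up_log 2 N.+1)%:R * rho ^+ 2 *
      budget sigma w N.+1 (\sum_(0 <= i < N) `|theta (a + i.+1)%N - theta (a + i)%N|)
    <= 48 * (up_log 2 n)%:R * rho ^+ 2 * budget sigma w N.+2 V.
  apply: ler_pM => //.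
  - by rewrite !mulr_ge0//; nra.
  - by apply: budget_ge0 => //; apply: sumr_ge0.
  - by rewrite ler_wpM2r ?ler_wpM2l//; nra.
rewrite E2 in Hc; move: H1 Hc E5 rsN rsl rs D00 MB.
move: (_ * budget _ _ _ _) (_ * budget _ _ _ _) => X Y.
move: (ln _) (ln _) => l1 l2.
move: (rho ^+ 2) (sigma ^+ 2) rr1 ss0 => r s rr1 ss0.
move: (\sum_(_ <= _ < _) _) (\sum_(_ <= _ < _) _) => S1 S2.
by nra.
Qed.

Lemma bin_restart_cost (R : realType) (theta z : nat -> R) (n a N : nat)
    (sigma rho w : R) :
  0 < sigma -> 1 <= rho -> 0 < w -> (0 < a)%N -> (a + N <= n)%N ->
  interval_noise_bound z n (rho * sigma / 2) ->
  arrows_restart sigma (rho * sigma)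
    (segment (fun t => theta t + z t) a (a + N)) ->
  sigma ^+ 2 <= 2 * (up_log 2 n)%:R *
    budget sigma w N.+1 (\sum_(a <= t < a + N) `|theta t.+1 - theta t|).
Proof.
move=> s0 r1 w0 a0 aN Hz; rewrite arrows_restartE.
have -> : ((a + N).+1 - a = N.+1)%N by lia.
move=> Hr.
have c0 : 0 <= rho * sigma / 2 by rewrite !mulr_ge0// ?ltW//; lra.
have [_ kL] := up_log2_bounds (ltn0Sn N).
have H := @restart_cost _ (fun i => theta (a + i)%N) (fun i => z (a + i)%N) N
  sigma (rho * sigma) w s0.
apply: (le_trans (H _ w0 _ Hr)); first by lra.
  move=> l j lm; rewrite (_ : rho * sigma = 2 * (rho * sigma / 2)); last by field.
  apply: haar_centered_noise => // p q pq.
  exact: (interval_noise_bound_shift Hz a0 aN).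
rewrite -(sum_shift0 (fun t => `|theta t.+1 - theta t|)).
rewrite (eq_bigr (fun i => `|theta (a + i).+1 - theta (a + i)%N|)); last first.
  by move=> i _; rewrite addnS.
rewrite ler_wpM2r ?budget_ge0 ?sumr_ge0// ler_wpM2l// ler_nat leq_up_log//; lia.
Qed.

(** * Accumulation over the bins *)

(** The squared increments start at index 0: with [theta 0 = 0] the first one is the square of
    [theta 1]. *)
Definition potential {R : realType} (theta : nat -> R) (sigma w K : R) (u : nat) : R :=
  K * budget sigma w u (\sum_(1 <= t < u) `|theta t.+1 - theta t|)
  + 3 * \sum_(0 <= t < u) (theta t.+1 - theta t) ^+ 2.

Lemma bin_lossS (R : realType) (theta y : nat -> R) (a N : nat) :
  bin_loss theta y a N.+1 = bin_loss theta y a N +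
  ((\sum_(a <= i < a + N.+1) y i) / N.+1%:R - theta (a + N.+1)%N) ^+ 2.
Proof. by rewrite /bin_loss big_nat_recr//= addrA sum_shift0. Qed.

(** Bin lengths and ranges of squared increments add up exactly; the ranges of variation are
    disjoint and skip the increment at [a - 1]. *)
Lemma potential_step (R : realType) (theta : nat -> R) (sigma w K : R) (a N : nat) :
  0 < sigma -> 0 < w -> 0 <= K -> (0 < a)%N ->
  potential theta sigma w K a.-1
  + K * budget sigma w N.+1 (\sum_(a <= t < a + N) `|theta t.+1 - theta t|)
  + 3 * \sum_(a.-1 <= t < a + N) (theta t.+1 - theta t) ^+ 2
  <= potential theta sigma w K (a + N).
Proof.
move=> s0 w0 K0; case: a => [//|a] _; rewrite /potential/= addSnnS.
rewrite [\sum_(0 <= t < a + N.+1) _](@big_cat_nat _ _ _ a)//= ?leq_addr//.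
pose V p q := \sum_(p <= t < q) `|theta t.+1 - theta t|.
rewrite -!/(V _ _).
have VV : V 1%N a + V a.+1 (a + N.+1)%N <= V 1%N (a + N.+1)%N.
  rewrite /V [leRHS](@big_cat_nat _ _ _ a.+1)//= ?addnS ?ltnS ?leq_addr//.
  rewrite lerD2r; case: a => [|a]; first by rewrite !big_geq.
  by rewrite [leRHS]big_nat_recr//= lerDl.
have Hb : budget sigma w a (V 1%N a) + budget sigma w N.+1 (V a.+1 (a + N.+1)%N)
    <= budget sigma w (a + N.+1) (V 1%N (a + N.+1)%N).
  rewrite /budget natrD.
  have : sigma * (V 1%N a + V a.+1 (a + N.+1)%N) / w <= sigma * V 1%N (a + N.+1)%N / w.
    by rewrite ler_wpM2r ?invr_ge0 ?(ltW w0)// ler_wpM2l// ltW.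
  move: (V _ _) (V _ _) (V _ _) (w^-1) (a%:R) (N.+1%:R) => *; lra.
move: (ler_wpM2l K0 Hb).
move: (budget _ _ _ _) (budget _ _ _ _) (budget _ _ _ _) => x y u.
move: (\sum_(_ <= _ < _) _) (\sum_(_ <= _ < _) _) => *; lra.
Qed.

(** Induction over time. Where a bin opens, the past loss is covered by the potential alone; inside
    it an extra [C0] is allowed, and a restart pays that [C0] back through [bin_restart_cost]. Only
    the last bin leaves it unpaid. *)
Lemma arrows_regret_potential (R : realType) (theta z : nat -> R) (n : nat)
    (sigma rho beta w : R) :
  0 < sigma -> 1 <= rho -> 0 < w -> (0 < n)%N ->
  theta 0%N = 0 -> z 0%N = 0 ->
  arrows_lambda n sigma beta = rho * sigma ->
  interval_noise_bound z n (rho * sigma / 2) ->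
  \sum_(1 <= t < n.+1)
    (arrows_pred n sigma beta (fun s => theta s + z s) t - theta t) ^+ 2 <=
  potential theta sigma w (64 * (up_log 2 n)%:R * rho ^+ 2 * (1 + ln n%:R)) n
  + 8 * rho ^+ 2 * (1 + ln n%:R) * sigma ^+ 2.
Proof.
move=> s0 r1 w0 n0 th0 z0 lamE Hz.
set y := fun s => theta s + z s.
have y0E : (fun i => if i == 0%N then 0 else y i) = y.
  by apply/funext => -[|i]//=; rewrite /y th0 z0 addr0.
set reg := fun t => \sum_(1 <= s < t.+1) (arrows_pred n sigma beta y s - theta s) ^+ 2.
have regS t : reg t.+1 = reg t + (arrows_pred n sigma beta y t.+1 - theta t.+1) ^+ 2.
  by rewrite /reg big_nat_recr.
set K := 64 * _ * _ * _; set C0 := 8 * _ * _ * _.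
have lnn : 0 <= ln n%:R :> R by rewrite ln_ge0// ler1n; lia.
have rr1 : 1 <= rho ^+ 2 by nra.
have M0 : 0 <= (up_log 2 n)%:R :> R by [].
have K0 : 0 <= K by rewrite /K !mulr_ge0//; lra.
have C00 : 0 <= C0 by rewrite /C0 !mulr_ge0// ?sqr_ge0//; lra.
have step a N : (0 < a)%N -> (a + N <= n)%N ->
    reg a.-1 <= potential theta sigma w K a.-1 ->
    ((0 < N)%N -> ~~ arrows_restart sigma (rho * sigma) (segment y a (a + N).-1)) ->
    reg (a + N)%N = reg a.-1 + bin_loss theta y a N ->
    (reg (a + N)%N <= potential theta sigma w K (a + N) + C0) /\
    (arrows_restart sigma (rho * sigma) (segment y a (a + N)) ->
     reg (a + N)%N <= potential theta sigma w K (a + N)).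
  move=> a0 aN Ha Hr ->.
  have Hs := potential_step theta N s0 w0 K0 a0.
  have Hl := bin_loss_le s0 r1 w0 a0 aN z0 Hz Hr.
  move: Hs Hl; set V := \sum_(a <= t < a + N) _; set S := \sum_(a.-1 <= t < a + N) _.
  have V0 : 0 <= V by apply: sumr_ge0.
  have B0 := budget_ge0 N.+1 s0 w0 V0.
  move=> Hs Hl.
  have MrB : 0 <= (up_log 2 n)%:R * rho ^+ 2 * budget sigma w N.+1 V.
    by rewrite !mulr_ge0//; lra.
  have MrBl : 0 <= (up_log 2 n)%:R * rho ^+ 2 * budget sigma w N.+1 V * ln n%:R.
    by rewrite mulr_ge0.
  split.
    move: Hs Hl Ha; rewrite /K /C0 => Hs Hl Ha; nra.
  move=> Hre.
  have := bin_restart_cost s0 r1 w0 a0 aN Hz Hre; rewrite -/V => Hc.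
  (* The 64 in [K] is 48 for the loss in the bin plus 16 for paying off [C0]. *)
  have : C0 <= 16 * (up_log 2 n)%:R * rho ^+ 2 * (1 + ln n%:R) * budget sigma w N.+1 V.
    rewrite /C0.
    have : 0 <= 8 * rho ^+ 2 * (1 + ln n%:R) by rewrite !mulr_ge0//; lra.
    move=> /ler_wpM2l /(_ _ _ Hc) H; apply: (le_trans H).
    by rewrite le_eqVlt; apply/orP; left; apply/eqP; ring.
  move: Hs Hl Ha; rewrite /K -/C0 => Hs Hl Ha; nra.
pose st t := arrows_state n sigma beta y t.
have predE t : arrows_pred n sigma beta y t.+1 =
    if (st t).2 then y t
    else (\sum_((st t).1 <= i < t.+1) y i) / (t.+1 - (st t).1)%N%:R.
  have y0i i : (if i == 0%N then 0 else y i) = y i by rewrite -[RHS](congr1 (@^~ i) y0E).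
  rewrite /arrows_pred; cbv zeta; rewrite y0E y0i.
  by under eq_bigr do rewrite y0i.
(* The flag is set exactly when the bin start is [t.+1]. The last clause concerns a bin that already
   holds an observation. *)
suff inv t : (t <= n)%N -> [/\ (0 < (st t).1 <= t.+1)%N,
    (st t).2 = ((st t).1 == t.+1),
    reg (st t).1.-1 <= potential theta sigma w K (st t).1.-1,
    reg t <= potential theta sigma w K t + C0 &
    ((st t).1 <= t)%N ->
      reg t = reg (st t).1.-1 + bin_loss theta y (st t).1 (t - (st t).1) /\
      ~~ arrows_restart sigma (rho * sigma) (segment y (st t).1 t)].
  by have [] := inv n (leqnn n).
elim: t => [_|t IH tn].
  have r0 : reg 0%N = 0 by rewrite /reg big_geq.
  have p0 : 0 <= potential theta sigma w K 0.
    by rewrite /potential !big_geq// /budget; lra.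
  split=> //=; rewrite r0//; first exact: addr_ge0.
have [/andP[a0 at1] nb Ha _ Hin] := IH (ltnW tn).
set a := (st t).1 in a0 at1 nb Ha Hin *.
pose N := (t.+1 - a)%N; have Nt : (a + N = t.+1)%N := subnKC at1.
have at_ : a <> t.+1 -> (a <= t)%N.
  by move=> /eqP ne; rewrite -ltnS ltn_neqAle ne.
have Hreg : reg (a + N)%N = reg a.-1 + bin_loss theta y a N.
  rewrite Nt regS predE nb -/a; case: eqP => at1E.
    by rewrite /N at1E subnn /bin_loss big_geq// addr0.
  have [-> _] := Hin (at_ at1E).
  have NS : N = (t - a).+1 by rewrite /N subSn// at_.
  by rewrite -/N NS bin_lossS -NS Nt [RHS]addrA.
have Hnr : (0 < N)%N -> ~~ arrows_restart sigma (rho * sigma) (segment y a (a + N).-1).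
  by rewrite subn_gt0 ltnS => /Hin[_]; rewrite Nt.
have [S1 S2] := step a N a0 (etrans (congr1 (leq^~ n) Nt) tn) Ha Hnr Hreg.
rewrite Nt in S1 S2 Hreg.
have stS : st t.+1 = if arrows_restart sigma (rho * sigma) (segment y a t.+1)
    then (t.+2, true) else (a, false) by rewrite /st /= lamE.
rewrite stS; case: ifP => Hre /=.
  by split=> //; rewrite ?eqxx// ?ltnn//; exact: S2.
split=> //.
- by rewrite a0 leqW.
- by apply/esym/eqP => aE; move: at1; rewrite aE ltnn.
by move=> _; rewrite Hre.
Qed.

(** * Choice of the scale and final assembly *)

Lemma powR_thirds (R : realType) (x : R) (k : nat) : 0 <= x ->
  powR x (k%:R / 3) = powR x (1 / 3) ^+ k.
Proof.
move=> x0; rewrite -powR_mulrn ?powR_ge0// -powRrM.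
by congr powR; rewrite mulrC mul1r.
Qed.

Lemma budget_optimal (R : realType) (sigma V : R) (n : nat) :
  0 < sigma -> 0 <= V -> (0 < n)%N ->
  exists2 w : R, 0 < w & budget sigma w n V <=
    2 * (powR n%:R (1/3) * powR V (2/3) * powR sigma (4/3)) + sigma ^+ 2.
Proof.
move=> s0 V0 n0.
have nR : 0 < n%:R :> R by rewrite ltr0n.
have [VE|Vne] := eqVneq V 0.
  (* Without variation any small scale works; this one costs exactly [sigma ^+ 2]. *)
  exists (Num.sqrt n%:R)^-1; first by rewrite invr_gt0 sqrtr_gt0.
  rewrite /budget VE mulr0 mul0r addr0 exprVn sqr_sqrtr// mulrAC divff ?gt_eqF//.
  by rewrite [leLHS]mul1r lerDr !mulr_ge0// powR_ge0.
have Vgt0 : 0 < V by rewrite lt_def Vne.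
rewrite (powR_thirds 2)// (powR_thirds 4) ?(ltW s0)//.
have cube (x : R) : 0 < x -> powR x (1 / 3) ^+ 3 = x.
  by move=> x0; rewrite -powR_thirds ?(ltW x0)// divff// powRr1// ltW.
have [[np Vp] sp] := (cube _ nR, cube _ Vgt0, cube _ s0).
have p0 : 0 < powR n%:R (1 / 3) :> R by exact: powR_gt0.
have q0 : 0 < powR V (1 / 3) by exact: powR_gt0.
have t0 : 0 < powR sigma (1 / 3) by exact: powR_gt0.
rewrite /budget; move: np Vp sp p0 q0 t0.
move: (powR _ _) (powR _ _) (powR _ _) => p q t <- <- <- p0 q0 t0.
(* The balancing scale: both terms of [budget] become [p * q ^+ 2 * t ^+ 4]. *)
exists (q / (p * t)); first by rewrite divr_gt0// mulr_gt0.
rewrite -[leLHS]addr0 lerD ?sqr_ge0// le_eqVlt; apply/orP; left; apply/eqP.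
by field; rewrite !gt_eqF.
Qed.

Lemma ln2_ge (R : realType) : 1 / 2 <= ln 2 :> R.
Proof.
have : ln (1 + (- (1 / 2))) <= - (1 / 2) :> R by apply: le_ln1Dx; lra.
have -> : 1 + - (1 / 2) = 2^-1 :> R by field.
by rewrite lnV ?posrE//; lra.
Qed.

Lemma up_log2_le_ln (R : realType) (n : nat) : (2 <= n)%N ->
  (up_log 2 n)%:R <= 1 + 2 * ln n%:R :> R.
Proof.
move=> n2; have /andP[H _] := @up_log_bounds 2 n isT n2.
have m0 : (0 < up_log 2 n)%N by rewrite up_log_gt0.
rewrite -(prednK m0) -natr1 addrC lerD2l.
move: H; set m := (up_log 2 n).-1 => H.
have : ln (2 ^+ m) <= ln n%:R :> R.
  by rewrite ler_ln ?posrE ?exprn_gt0// ?ltr0n ?(ltnW n2)// -natrX ler_nat ltnW.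
rewrite lnXn// -[ln 2 *+ m]mulr_natr => H2.
have := ler_wpM2r (ler0n R m) (ln2_ge R); lra.
Qed.

Lemma eq_arrows_pred (R : realType) (n : nat) (sigma beta : R) (y y' : nat -> R)
    (t : nat) :
  (forall i, (0 < i)%N -> y i = y' i) ->
  arrows_pred n sigma beta y t = arrows_pred n sigma beta y' t.
Proof.
move=> yy'; rewrite /arrows_pred.
have E : (fun i => if i == 0%N then 0 else y i) = (fun i => if i == 0%N then 0 else y' i).
  by apply/funext => -[|i]//=; exact: yy'.
cbv zeta; rewrite E; congr (if _ then _ else _ / _).
  exact: (congr1 (@^~ t.-1) E).
by apply: eq_bigr => i _; exact: (congr1 (@^~ i) E).
Qed.

Lemma arrows_regret_le (R : realType) (theta z : nat -> R) (n : nat)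
    (sigma rho beta Lam : R) :
  0 < sigma -> 1 <= rho -> rho ^+ 2 <= 24 * Lam -> 1 + ln n%:R <= Lam ->
  (2 <= n)%N ->
  arrows_lambda n sigma beta = rho * sigma ->
  interval_noise_bound z n (rho * sigma / 2) ->
  \sum_(1 <= t < n.+1)
    (arrows_pred n sigma beta (fun s => theta s + z s) t - theta t) ^+ 2 <=
  6144 * Lam ^+ 3 *
     (powR n%:R (1/3) * powR (\sum_(1 <= t < n) `|theta t.+1 - theta t|) (2/3)
        * powR sigma (4/3)
      + `|theta 1%N| ^+ 2 + \sum_(1 <= t < n) (theta t.+1 - theta t) ^+ 2
      + sigma ^+ 2).
Proof.
move=> s0 r1 rL lL n2 lamE Hz.
have n0 : (0 < n)%N := ltnW n2.
(* Zeroing index 0 makes the convention [y 0 = 0] hold and turns the first increment into [theta 1];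
   no prediction changes. *)
pose th i := if i == 0%N then 0 else theta i.
pose zz i := if i == 0%N then 0 else z i.
set V := \sum_(1 <= t < n) `|_|; have V0 : 0 <= V by apply: sumr_ge0.
have [w w0 Hw] := budget_optimal s0 V0 n0.
have Hzz : interval_noise_bound zz n (rho * sigma / 2).
  move=> p q /andP[p0 pq] qn; rewrite (eq_big_nat _ _ (F2 := z)).
    by apply: Hz => //; rewrite p0.
  by move=> [|i] // /andP[]; rewrite leqn0 => /eqP pE; rewrite pE in p0.
have := arrows_regret_potential s0 r1 w0 n0 (erefl : th 0%N = 0)
  (erefl : zz 0%N = 0) lamE Hzz.
rewrite (eq_big_nat _ _ (F2 := fun t => (arrows_pred n sigma beta
    (fun s => theta s + z s) t - theta t) ^+ 2)); last first.
  move=> [|t]// _; rewrite (@eq_arrows_pred _ _ _ _ _ (fun s => theta s + z s))//.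
  by move=> [|i].
move=> /le_trans; apply; rewrite /potential.
have -> : \sum_(1 <= t < n) `|th t.+1 - th t| = V.
  by apply: eq_big_nat => -[|t].
have -> : \sum_(0 <= t < n) (th t.+1 - th t) ^+ 2 =
    `|theta 1%N| ^+ 2 + \sum_(1 <= t < n) (theta t.+1 - theta t) ^+ 2.
  rewrite big_ltn//; congr (_ + _).
    by rewrite /th/= subr0 real_normK ?num_real.
  by apply: eq_big_nat => -[|t].
set S := \sum_(1 <= t < n) (_ ^+ 2); set Q := _ * _ * powR sigma _ in Hw *.
have Q0 : 0 <= Q by rewrite !mulr_ge0// powR_ge0.
have S0 : 0 <= S by apply: sumr_ge0 => t _; exact: sqr_ge0.
have T0 : 0 <= `|theta 1%N| ^+ 2 by exact: sqr_ge0.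
have ss0 : 0 <= sigma ^+ 2 by exact: sqr_ge0.
have lnn : 0 <= ln n%:R :> R by rewrite ln_ge0// ler1n.
have L1 : 1 <= Lam by lra.
have B0 := budget_ge0 n s0 w0 V0.
have Mle : (up_log 2 n)%:R <= 2 * Lam.
  by have := up_log2_le_ln R n2; lra.
(* The three logarithmic factors are at most [2 * Lam], [24 * Lam] and [Lam]; the 2 in front of [Q]
   later doubles 3072 to 6144. *)
have KL : 64 * (up_log 2 n)%:R * rho ^+ 2 * (1 + ln n%:R) <= 3072 * Lam ^+ 3.
  have -> : 3072 * Lam ^+ 3 = 64 * (2 * Lam) * (24 * Lam) * Lam by ring.
  have r0 := sqr_ge0 rho.
  apply: ler_pM => //; [by rewrite mulr_ge0|lra|].
  by apply: ler_pM => //; rewrite ler_wpM2l.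
have L2 : Lam <= Lam ^+ 2 by nra.
have L3 : Lam ^+ 2 <= Lam ^+ 3 by rewrite [leRHS]exprSr; nra.
have KB : 64 * (up_log 2 n)%:R * rho ^+ 2 * (1 + ln n%:R) * budget sigma w n V
    <= 3072 * Lam ^+ 3 * (2 * Q + sigma ^+ 2).
  by apply: ler_pM => //; rewrite !mulr_ge0 ?sqr_ge0//; lra.
have CB : 8 * rho ^+ 2 * (1 + ln n%:R) * sigma ^+ 2 <= 192 * Lam ^+ 3 * sigma ^+ 2.
  rewrite ler_wpM2r//; apply: (@le_trans _ _ (8 * (24 * Lam) * Lam)).
    apply: ler_pM => //; [by rewrite mulr_ge0 ?sqr_ge0|lra|].
    by rewrite ler_wpM2l.
  by nra.
have TB : `|theta 1%N| ^+ 2 + S <= Lam ^+ 3 * (`|theta 1%N| ^+ 2 + S).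
  by rewrite ler_peMl ?addr_ge0//; lra.
have SB : 0 <= Lam ^+ 3 * sigma ^+ 2 by rewrite mulr_ge0//; lra.
have TS : 0 <= Lam ^+ 3 * (`|theta 1%N| ^+ 2 + S) by rewrite mulr_ge0 ?addr_ge0//; lra.
move: KB CB TB SB TS; move: (64 * _ * _ * _ * _) (8 * _ * _ * _) (`|theta 1%N| ^+ 2) => X Y Z.
move: (Lam ^+ 3) (sigma ^+ 2) => L s; lra.
Qed.

Theorem theorem1 (R : realType) :
  exists (C : R) (k : nat), 0 < C /\
  forall (n : nat) (sigma delta : R),
    (2 <= n)%N -> 0 < sigma -> 0 < delta -> delta <= 1 ->
  let beta := 24 + 8 * ln (8 / delta) / ln (n%:R) in
  forall (theta : nat -> R) (d : measure_display) (T : measurableType d)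
         (P : probability T R) (Z : nat -> {RV P >-> R}),
    mutually_independent P (fun i : 'I_n => (Z i.+1 : T -> R)) ->
    (forall t, (1 <= t <= n)%N -> ('E_P[Z t] = 0)%E) ->
    (forall t, (1 <= t <= n)%N -> subgaussian P sigma (Z t)) ->
  exists E : set T, measurable E /\ (P E >= (1 - delta)%:E)%E /\
    forall w, E w ->
      \sum_(1 <= t < n.+1)
          (arrows_pred n sigma beta (fun s => theta s + Z s w) t - theta t) ^+ 2
      <= C * (1 + ln (n%:R) + ln (delta^-1)) ^+ k *
         ( powR (n%:R) (1/3) *
             powR (\sum_(1 <= t < n) `|theta t.+1 - theta t|) (2/3) *
             powR sigma (4/3)
           + `|theta 1%N| ^+ 2
           + \sum_(1 <= t < n) (theta t.+1 - theta t) ^+ 2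
           + sigma ^+ 2 ).
Proof.
exists 6144, 3%N; split; first by rewrite ltr0n.
move=> n sigma delta n2 s0 d0 d1 beta theta d T P Z indep _ sub.
have nR : 0 < n%:R :> R by rewrite ltr0n ltnW.
have n1 : 1 < n%:R :> R by rewrite ltr1n.
have ln0 : 0 < ln n%:R :> R by rewrite ln_gt0.
have ld0 : 0 <= ln delta^-1 by rewrite ln_ge0// invf_ge1.
have l8 : ln (8 / delta) = 3 * ln 2 + ln delta^-1.
  rewrite lnM ?posrE ?invr_gt0//; congr (_ + _).
  have -> : 8 = 2 ^+ 3 :> R by rewrite -natrX.
  by rewrite lnXn// mulr_natl.
have l2 : ln 2 <= 1 :> R.
  by rewrite (_ : 2 = 1 + 1)//; apply: le_ln1Dx; lra.
have l2' := ln2_ge R.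
have bE : beta * ln n%:R = 24 * ln n%:R + 8 * ln (8 / delta).
  by rewrite /beta; field; rewrite gt_eqF.
(* The threshold is [rho * sigma]; interval sums are controlled at half of it because
   [haar_centered_noise] loses a factor 2. *)
set rho := Num.sqrt (beta * ln n%:R).
have rsq : rho ^+ 2 = 24 * ln n%:R + 8 * ln (8 / delta).
  by rewrite /rho sqr_sqrtr bE// l8; lra.
have r1 : 1 <= rho.
  rewrite -(ler_pXn2r (n := 2)) ?nnegrE ?sqrtr_ge0// expr1n rsq l8; lra.
have c0 : 0 < rho * sigma / 2 by rewrite !mulr_gt0//; lra.
have [E [mE PE HE]] := noise_event indep sub s0 c0.
exists E; split=> //; split.
  apply: le_trans PE; rewrite lee_fin lerD2l lerN2.
  (* The choice of [beta] makes [rho ^+ 2 / 8] equal to [3 ln n + ln (8 / delta)], so the failure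
     probability is at most [delta / (4 n)]. *)
  have -> : (rho * sigma / 2) ^+ 2 / (2 * sigma ^+ 2) = rho ^+ 2 / 8.
    by field; rewrite gt_eqF.
  have -> : - (rho ^+ 2 / 8) = - (ln n%:R *+ 3 + ln (8 / delta)).
    by rewrite rsq -[_ *+ 3]mulr_natl; field.
  rewrite expRN expRD -lnXn// !lnK ?posrE ?exprn_gt0 ?divr_gt0//.
  have -> : n%:R ^+ 2 * (2 * (n%:R ^+ 3 * (8 / delta))^-1) = delta / (4 * n%:R).
    by field; rewrite !gt_eqF.
  by rewrite ler_pdivrMr ?mulr_gt0// ler_peMr ?ltW//; lra.
move=> w Ew; apply: (@arrows_regret_le _ theta (fun s => Z s w) n sigma rho beta) => //.
- rewrite rsq l8; lra.
- lra.
- by rewrite /arrows_lambda mulrC.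
- exact: HE.
Qed.
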